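(* Let $n\in\{2,3\}$ and let $x_h=(r_h,q_h,p_h)\in X_h$ be the solution of the discrete problem with quadrature $\langle \mathcal{B}_h x_h,\tilde x\rangle=\langle f,\tilde x\rangle$ for all $\tilde x\in X_h$. Then the discrete velocity $q_h\in Q_h$ is pointwise solenoidal, i.e. $\nabla\cdot q_h=0$ pointwise in $\Omega$.
   Context: Setting. $\Omega\subset\mathbb{R}^n$, $n\in\{2,3\}$, is a simply connected Lipschitz domain with outward unit normal $\nu$; $\mu>0$ is a constant; $g\in (L^2(\Omega))^n$. The boundary is disjointly decomposed as $\partial\Omega=\partial_p\Omega\cup\partial_q\Omega$, and boundary data $p_0,q_0$ are given (such that the functional $f$ below is bounded). It is assumed that $\partial_p\Omega\neq\emptyset$ and $\|\nu\cdot\phi\|_{\partial_q\Omega}+\|\nu\times\phi\|_{\partial_p\Omega}>0$ for all rigid body motions $\phi\neq0$. $\|\cdot\|$ and $\langle\cdot,\cdot\rangle_\Omega$ are the $L^2(\Omega)$ norm and inner product. For $n=2$: $\nabla\times r=[\partial_2 r,-\partial_1 r]^T$ for scalar $r$, $\nabla\times q=\partial_1q_2-\partial_2q_1$ for vector $q$, the cross product with $\nu$ is defined analogously, and the vorticity $r$ is a scalar. Continuous spaces and forms. $X=R\times Q\times P$ with $R=\{r\in H(\mathrm{curl},\Omega):\nu\times r|_{\partial_q\Omega}=0\}$, $Q=\{q\in H(\mathrm{div},\Omega):\nu\cdot q|_{\partial_q\Omega}=0\}$, $P=L^2(\Omega)$. For $x=(r,q,p)$, $\tilde x=(\tilde r,\tilde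 q,\tilde p)\in X$, $$\langle\mathcal{B}x,\tilde x\rangle=\langle\mu^{-1}r,\tilde r\rangle_\Omega-\langle q,\nabla\times\tilde r\rangle_\Omega+\langle\nabla\times r,\tilde q\rangle_\Omega-\langle p,\nabla\cdot\tilde q\rangle_\Omega+\langle\nabla\cdot q,\tilde p\rangle_\Omega,$$ $$\langle f,\tilde x\rangle=\langle q_0,\nu\times\tilde r\rangle_{\partial_p\Omega}+\langle g,\tilde q\rangle_\Omega-\langle p_0,\nu\cdot\tilde q\rangle_{\partial_p\Omega}.$$ Discretization. $\Omega_h$ is a simplicial mesh of $\Omega$ (from a shape-regular family) with mesh size $h$. $X_h=R_h\times Q_h\times P_h$, where $Q_h$ is the lowest-order Raviart–Thomas space intersected with $Q$, $P_h$ is the space of piecewise constants, and $R_h$ is, for $n=3$, the space of linear Nédélec elements of the second kind intersected with $R$ and, for $n=2$, the space of continuous piecewise linear Lagrange elements intersected with $R$. One has $\nabla\times R_h\subseteq Q_h$ and $\nabla\cdot Q_h=P_h$. Quadrature. For elementwise linear (possibly discontinuous) functions $r,\tilde r$ on $\Omega_h$ ($\mathbb{R}^3$-valued if $n=3$, scalar if $n=2$), $$\langle r,\tilde r\rangle_h=\sum_{\omega\in\Omega_h}\frac{|\omega|}{n+1}\sum_{v\in\mathcal V(\omega)}(r_\omega\cdot\tilde r_\omega)(v),$$ with $r_\omega$ the restriction of $r$ to the simplex $\omega$ and $\mathcal V(\omega)$ its set of vertices. $\mathcal{B}_h$ is obtained from $\mathcal{B}$ on $X_h$ by replacing $\langle\mu^{-1}r,\tilde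 r\rangle_\Omega$ by $\langle\mu^{-1}r,\tilde r\rangle_h$. *)

(* Defs.v *)
From HB Require Import structures.
From mathcomp Require Import all_boot all_order all_algebra.
From mathcomp Require Import all_classical all_reals all_analysis.

Set Implicit Arguments.
Unset Strict Implicit.
Unset Printing Implicit Defensive.

Import Order.TTheory GRing.Theory Num.Theory.
Import numFieldNormedType.Exports.
Local Open Scope classical_set_scope.
Local Open Scope ring_scope.

(* The library norm on 'rV_n is the sup norm (it induces the usual topology);
   lengths and distances below are Euclidean. *)
Definition dot {R : realType} {n : nat} (u v : 'rV[R]_n) : R :=
  \sum_(i < n) u 0 i * v 0 i.

Definition enorm {R : realType} {n : nat} (u : 'rV[R]_n) : R :=
  Num.sqrt (dot u u).

Definition basis {R : realType} {n : nat} (i : 'I_n) : 'rV[R]_n :=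
  delta_mx 0 i.

(* The Borel sigma-algebra of R^n, as the product sigma-algebra: it is generated
   by the coordinate maps. *)
Definition rV_display (R : realType) (n : nat) : measure_display.
Proof. exact: default_measure_display. Qed.

Section measurable_rV.
Context {R : realType} (n : nat).

Let coord (i : 'I_n) (v : 'rV[R]_n) : measurableTypeR R := v 0 i.

Let rV_set0 : g_sigma_preimage coord set0.
Proof. exact: sigma_algebra0. Qed.

Let rV_setC A : g_sigma_preimage coord A -> g_sigma_preimage coord (~` A).
Proof. exact: sigma_algebraC. Qed.

Let rV_bigcup (F : (set 'rV[R]_n)^nat) :
  (forall i, g_sigma_preimage coord (F i)) ->
  g_sigma_preimage coord (\bigcup_i (F i)).
Proof. exact: sigma_algebra_bigcup. Qed.

HB.instance Definition _ := @isMeasurable.Build (rV_display R n)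
  'rV[R]_n (g_sigma_preimage coord) rV_set0 rV_setC rV_bigcup.

Lemma measurable_rV_coord (i : 'I_n) :
  measurable_fun setT (fun v : 'rV[R]_n => v 0 i).
Proof.
move=> _ Y mY; rewrite setTI; apply: sub_sigma_algebra => /=.
rewrite -bigcup_seq/=; exists i => /=; first by rewrite mem_index_enum.
by exists Y => //; rewrite setTI.
Qed.

End measurable_rV.

Fixpoint lebn {R : realType} (n : nat) : set 'rV[R]_n -> \bar R :=
  match n with
  | 0%N => fun A => \d_(0 : 'rV[R]_0) A
  | n'.+1 => fun A =>
      (\int[@lebesgue_measure R]_t
          lebn [set v : 'rV[R]_n' | A (row_mx (t%:M : 'rV[R]_1) v)])%E
  end.

Arguments lebn {R n}.

Section lebn_measure.
Context {R : realType}.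

Lemma sub_g_sigma_preimage d (T : measurableType d) n
    (f : 'I_n -> T -> measurableTypeR R) :
  (forall i, measurable_fun setT (f i)) -> g_sigma_preimage f `<=` measurable.
Proof.
move=> mf; apply: smallest_sub; first exact: sigma_algebra_measurable.
case: n => [|n] in f mf *; first by rewrite big_ord0.
rewrite -bigcup_mkord_ord; apply: bigcup_sub => i Ii.
by move=> A [B mB <-]; exact: mf.
Qed.

Lemma measurable_fun_rV d (T : measurableType d) n (f : T -> 'rV[R]_n) :
  (forall i, measurable_fun setT (fun t => f t 0 i)) -> measurable_fun setT f.
Proof.
move=> mf _ A mA; rewrite setTI.
apply: (sub_g_sigma_preimage mf).
rewrite (g_sigma_preimage_comp (fun i (v : 'rV[R]_n) => v 0 i : measurableTypeR R) f).
by exists A => //; rewrite setTI.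
Qed.

Let glue n (x : measurableTypeR R * 'rV[R]_n) : 'rV[R]_n.+1 :=
  row_mx (x.1%:M : 'rV[R]_1) x.2.

Let cut n (v : 'rV[R]_n.+1) : measurableTypeR R * 'rV[R]_n :=
  (v 0 0, rsubmx (v : 'rV[R]_(1 + n))).

Let cutK n : cancel (@cut n) (@glue n).
Proof.
move=> v; apply/rowP => i; rewrite /glue /cut mxE.
case: splitP => j ji; rewrite !mxE.
  rewrite ord1 eqxx mulr1n; congr (v _ _); apply/val_inj.
  by rewrite /= ji ord1.
by congr (v _ _); apply/val_inj; rewrite /= ji.
Qed.

Let glueK n : cancel (@glue n) (@cut n).
Proof.
move=> [t v]; rewrite /cut /glue /= row_mxKr; congr pair.
have -> : (0 : 'I_n.+1) = lshift n (0 : 'I_1) by apply/val_inj.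
by rewrite (row_mxEl (t%:M : 'rV[R]_1) v) mxE eqxx mulr1n.
Qed.

Let measurable_glue n : measurable_fun setT (@glue n).
Proof.
apply: measurable_fun_rV => i.
case: (splitP (i : 'I_(1 + n))) => j ji.
  rewrite (_ : (fun _ => _) = fst); first exact: measurable_fst.
  apply/funext => x /=.
  have -> : i = lshift n (0 : 'I_1) by apply/val_inj; move: ji; rewrite ord1.
  by rewrite /glue (row_mxEl (x.1%:M : 'rV[R]_1) x.2) mxE eqxx mulr1n.
rewrite (_ : (fun _ => _) = (fun v : 'rV[R]_n => v 0 j) \o snd).
  apply: measurableT_comp; [exact: measurable_rV_coord|exact: measurable_snd].
apply/funext => x /=.
have -> : i = rshift 1 j by apply/val_inj; exact: ji.
by rewrite /glue (row_mxEr (x.1%:M : 'rV[R]_1) x.2).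
Qed.

Let measurable_cut n : measurable_fun setT (@cut n).
Proof.
apply/measurable_fun_pairP; split; first exact: measurable_rV_coord.
apply: measurable_fun_rV => i /=.
rewrite (_ : (fun _ => _) = (fun v : 'rV[R]_n.+1 => v 0 (rshift 1 i))).
  exact: measurable_rV_coord.
by apply/funext => v; rewrite /= mxE.
Qed.

Let sigma_finite_pack d (T : measurableType d) (m : {measure set T -> \bar R}) :
  sigma_finite setT m ->
  exists mu : {sigma_finite_measure set T -> \bar R}, (mu : set T -> \bar R) = m.
Proof.
move=> sf.
pose H1 := isSFinite.Build _ _ _ m (sfinite_measure_sigma_finite sf).
pose H2 := isSigmaFinite.Build _ _ _ m sf.
pose mm : {sigma_finite_measure set T -> \bar R} :=
  HB.pack (Measure.sort m) (Measure.class m) H1 H2.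
by exists mm.
Qed.

Let prod_sigma_finite d1 d2 (T1 : measurableType d1) (T2 : measurableType d2)
    (m1 : {sigma_finite_measure set T1 -> \bar R})
    (m2 : {sigma_finite_measure set T2 -> \bar R}) :
  sigma_finite setT (m1 \x m2)%E.
Proof.
have /sigma_finiteP[F [TF ndF Foo]] := sigma_finiteT m1.
have /sigma_finiteP[G [TG ndG Goo]] := sigma_finiteT m2.
exists (fun n => F n `*` G n).
  rewrite -setXTT TF TG predeqE => -[x y]; split.
    move=> [/= [n _ Fnx] [k _ Gky]]; exists (maxn n k) => //; split.
    - by move: x Fnx; exact/subsetPset/ndF/leq_maxl.
    - by move: y Gky; exact/subsetPset/ndG/leq_maxr.
  by move=> [n _ []/= ? ?]; split; exists n.
move=> k; have [? ?] := Foo k; have [? ?] := Goo k.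
split; first exact: measurableX.
by rewrite product_measure1E// lte_mul_pinfty// ge0_fin_numE.
Qed.

Let lebn_ex n : exists mu : {sigma_finite_measure set 'rV[R]_n -> \bar R},
  (mu : set 'rV[R]_n -> \bar R) = @lebn R n.
Proof.
elim: n => [|n [mu muE]].
  apply: (@sigma_finite_pack _ _ (dirac (0 : 'rV[R]_0))).
  exists (fun=> setT); first by rewrite bigcup_const.
  by move=> _; split => //=; rewrite diracT ltry.
pose m2' : {measure set 'rV[R]_n.+1 -> \bar R} :=
  pushforward (@lebesgue_measure R \x mu)%E (@glue n).
pose m2 := m2' (@measurable_glue n).
have mE : (m2 : set _ -> _) = @lebn R n.+1.
  apply/funext => A; rewrite /= /pushforward /product_measure1.
  apply: eq_integral => t _ /=; rewrite -muE; congr (mu _).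
  by apply/seteqP; split => v /=; rewrite /xsection /= inE.
rewrite -mE; apply: sigma_finite_pack.
have [F FT Ffin] := prod_sigma_finite (@lebesgue_measure R) mu.
exists (fun k => @cut n @^-1` F k) => [|k].
  by rewrite -preimage_bigcup -FT preimage_setT.
have [mF Foo] := Ffin k; split; first by rewrite -[X in measurable X]setTI; exact: measurable_cut.
suff -> : m2 (@cut n @^-1` F k) = (@lebesgue_measure R \x mu)%E (F k) by [].
rewrite /m2 /= /pushforward -comp_preimage.
by rewrite (_ : _ \o _ = id) ?preimage_id//; apply/funext => x /=; exact: glueK.
Qed.

Let lebn0 n : @lebn R n set0 = 0%E.
Proof. by have [mu <-] := lebn_ex n; rewrite measure0. Qed.

Let lebn_ge0 n A : (0 <= @lebn R n A)%E.
Proof. by have [mu <-] := lebn_ex n; exact: measure_ge0. Qed.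

Let lebn_sigma_additive n : semi_sigma_additive (@lebn R n).
Proof. by have [mu <-] := lebn_ex n; exact: measure_semi_sigma_additive. Qed.

HB.instance Definition _ n := isMeasure.Build _ _ _
  (@lebn R n) (@lebn0 n) (@lebn_ge0 n) (@lebn_sigma_additive n).

Let lebn_sigma_finite n : sigma_finite setT (@lebn R n).
Proof. by have [mu <-] := lebn_ex n; exact: sigma_finiteT. Qed.

HB.instance Definition _ n := Measure_isSigmaFinite.Build _ _ _
  (@lebn R n) (@lebn_sigma_finite n).

End lebn_measure.

(* The s-dimensional Hausdorff outer measure on R^n, normalised so as to give
   the s-dimensional area (a set of diameter d counts as a ball of diameter d).
   Integrals against it use its Caratheodory sigma-algebra. *)
Section hausdorff.
Context {R : realType} {n : nat} (s : nat).
Implicit Types (U : set 'rV[R]_n) (A : set 'rV[R]_n).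
Local Open Scope ereal_scope.

Definition diam1_volume : R :=
  fine (lebn [set x : 'rV[R]_s | (enorm x <= 2^-1)%R]).

Definition hgauge U : \bar R := ereal_sup [set z | z = 0 \/
  exists x y, [/\ U x, U y & z = (diam1_volume * enorm (x - y) ^+ s)%:E]].

Definition hcover (d : R) A (U : (set 'rV[R]_n)^nat) : Prop :=
  (forall k x y, U k x -> U k y -> (enorm (x - y) <= d)%R) /\
  A `<=` \bigcup_k U k.

Definition hpre (d : R) A : \bar R :=
  ereal_inf [set \sum_(k <oo) hgauge (U k) | U in hcover d A].

Definition hausdorff A : \bar R :=
  ereal_sup [set hpre d A | d in [set d | (0 < d)%R]].

Let hgauge_ge0 U : 0 <= hgauge U.
Proof. by apply: ereal_sup_ubound; left. Qed.

Let hgauge0 : hgauge set0 = 0.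
Proof.
apply/eqP; rewrite eq_le hgauge_ge0 andbT.
by apply: ge_ereal_sup => z [->//|[x [y []]]].
Qed.

Let hpre_ge0 d A : 0 <= hpre d A.
Proof.
by apply: le_ereal_inf_tmp => _ [U _ <-]; exact: nneseries_ge0.
Qed.

Let hpre_le d A B : A `<=` B -> hpre d A <= hpre d B.
Proof.
move=> AB; apply: ereal_inf_le_tmp => _ [U [dU BU] <-].
by exists U => //; split => //; exact: subset_trans BU.
Qed.

Let hpre_sub d (A : (set 'rV[R]_n)^nat) :
  hpre d (\bigcup_k A k) <= \sum_(k <oo) hpre d (A k).
Proof.
have [[i ioo]|] := pselect (exists i, hpre d (A i) = +oo).
  rewrite (eseries_pinfty _ _ ioo) ?leey// => m _.
  by rewrite -ltNye (lt_le_trans _ (hpre_ge0 _ _)).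
rewrite -forallNE => Aoo.
suff add2e (e : {posnum R}) :
    hpre d (\bigcup_k A k) <= \sum_(i <oo) hpre d (A i) + e%:num%:E.
  by apply/lee_addgt0Pr => _/posnumP[].
rewrite (le_trans _ (epsilon_trick _ _ _))//.
pose P m (B : (set 'rV[R]_n)^nat) := hcover d (A m) B /\
  \sum_(k <oo) hgauge (B k) <= hpre d (A m) + (e%:num / (2 ^ m.+1)%:R)%:E.
have [G PG] : {G : ((set 'rV[R]_n)^nat)^nat & forall m, P m (G m)}.
  apply: (@choice _ _ P) => m; rewrite /P /hpre.
  set S := (X in ereal_inf X); move infS : (ereal_inf S) => iS.
  case: iS infS => [r Sr|Soo|Soo].
  - have en1 : (0 < e%:num / (2 ^ m.+1)%:R)%R by [].
    have /(lb_ereal_inf_adherent en1) : ereal_inf S \is a fin_num by rewrite Sr.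
    move=> [x [B [dB AmB] muBx] xS].
    by exists B; split => //; rewrite muBx -Sr; exact/ltW.
  - by have := Aoo m; rewrite /hpre Soo.
  - suff : lbound S 0 by move/le_ereal_inf_tmp; rewrite Soo.
    by move=> /= _ [B _ <-]; exact: nneseries_ge0.
have G_ge0 x : 0 <= (hgauge \o uncurry G) x by exact: hgauge_ge0.
apply: (@le_trans _ _ (\esum_(i in setT) (hgauge \o uncurry G) i)).
  rewrite /hpre; apply: ereal_inf_lbound => /=.
  have /card_esym/ppcard_eqP[f] := card_nat2.
  exists (uncurry G \o f).
    split => [i x y|]; first by move=> /=; case: (f i) => a b /=; exact: (PG a).1.1.
    apply: (@subset_trans _  (\bigcup_m \bigcup_k G m k)) => [t [i _]|].
      by move=> /((PG i).1.2) -[j _ ?]; exists i => //; exists j.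
    move=> t [i _ [j _ Bijt]]; exists (f^-1%FUN (i, j)) => //=.
    by rewrite invK ?inE.
  rewrite -(esum_pred_image (hgauge \o uncurry G) _ xpredT) ?[fun=> _]set_true//.
  by rewrite image_eq.
rewrite (_ : esum _ _ = \sum_(i <oo) \sum_(j <oo ) hgauge (G i j)); last first.
  pose J : nat -> set (nat * nat) := fun i => [set (i, j) | j in setT].
  rewrite (_ : setT = \bigcup_k J k); last first.
    by rewrite predeqE => -[a b]; split => // _; exists a => //; exists b.
  rewrite esum_bigcupT /=; last 2 first.
    - apply/trivIsetP => i j _ _ ij.
      rewrite predeqE => -[k m] /=; split => //= -[] [_] _ [<-{k} _].
      by move=> [m' _] [] /esym/eqP; rewrite (negbTE ij).
    - by move=> /= [k m]; exact: hgauge_ge0.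
  rewrite -(image_id [set: nat]) -fun_true esum_pred_image//; last first.
    by move=> k _; exact: esum_ge0.
  apply: eq_eseriesr => /= j _.
  rewrite -(esum_pred_image (hgauge \o uncurry G) (pair j) predT)//=; last first.
    by move=> ? ? _ _; exact: (@can_inj _ _ _ snd).
  by congr esum; rewrite predeqE => -[a b]; split; move=> [i _ <-]; exists i.
apply: lee_lim.
- apply: is_cvg_nneseries => m *.
  by apply: nneseries_ge0 => k *; exact: (G_ge0 (m, k)).
- by apply: is_cvg_nneseries => m *; apply: adde_ge0 => //; exact: hpre_ge0.
- by near=> m; apply: lee_sum => i _; exact: (PG i).2.
Unshelve. all: by end_near. Qed.

Let hausdorff_ge0 A : 0 <= hausdorff A.
Proof.
apply: (@le_trans _ _ (hpre 1 A)) => //.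
by apply: ereal_sup_ubound; exists 1%R => //=.
Qed.

Let hausdorff0 : hausdorff set0 = 0.
Proof.
apply/eqP; rewrite eq_le hausdorff_ge0 andbT.
apply: ge_ereal_sup => _ [d _ <-].
apply: ereal_inf_lbound; exists (fun=> set0).
  by split => // k x y.
by rewrite eseries0// => k _ _; exact: hgauge0.
Qed.

Let hausdorff_le : {homo hausdorff : A B / A `<=` B >-> A <= B}.
Proof.
move=> A B AB; apply: ge_ereal_sup => _ [d d0 <-].
apply: (le_trans (hpre_le d AB)).
by apply: ereal_sup_ubound; exists d.
Qed.

Let hausdorff_sub : sigma_subadditive hausdorff.
Proof.
move=> A; apply: ge_ereal_sup => _ [d d0 <-].
apply: (le_trans (hpre_sub d A)); apply: lee_nneseries => // k _.
by apply: ereal_sup_ubound; exists d.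
Qed.

HB.instance Definition _ := isOuterMeasure.Build R 'rV[R]_n hausdorff
  hausdorff0 hausdorff_ge0 hausdorff_le hausdorff_sub.

End hausdorff.

(* The surface measure on hypersurfaces of R^n. *)
Definition hausdorff_surface (R : realType) (n : nat) :
  {outer_measure set 'rV[R]_n -> \bar R} := @hausdorff R n n.-1.

Definition surf {R : realType} {n : nat} :
  {measure set (caratheodory_type (hausdorff_surface R n)) -> \bar R} :=
  hausdorff_surface R n.

Section calculus.
Context {R : realType} {n : nat}.
Implicit Types (Omega : set 'rV[R]_n).

Definition partial {V : normedModType R} (i : 'I_n) (f : 'rV[R]_n -> V)
    (x : 'rV[R]_n) : V :=
  'D_(basis i) f x.

Definition grad (phi : 'rV[R]_n -> R) (x : 'rV[R]_n) : 'rV[R]_n :=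
  \row_(i < n) partial i phi x.

Definition div (q : 'rV[R]_n -> 'rV[R]_n) (x : 'rV[R]_n) : R :=
  \sum_(i < n) partial i (fun y => q y 0 i) x.

Definition smooth (phi : 'rV[R]_n -> R) : Prop :=
  forall (s : seq 'I_n) x, differentiable (foldr partial phi s) x.

Definition test_function Omega (phi : 'rV[R]_n -> R) : Prop :=
  smooth phi /\ exists K : set 'rV[R]_n,
    [/\ compact K, K `<=` Omega & forall x, ~ K x -> phi x = 0].

Definition test_field Omega {k : nat} (phi : 'rV[R]_n -> 'rV[R]_k) : Prop :=
  forall j, test_function Omega (fun x => phi x 0 j).

Definition boundary Omega : set 'rV[R]_n := closure Omega `\` Omega°.

Definition L2 Omega (f : 'rV[R]_n -> R) : Prop :=
  measurable_fun Omega f /\ (\int[lebn]_(x in Omega) (f x ^+ 2)%:E < +oo)%E.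

Definition L2v Omega {k : nat} (u : 'rV[R]_n -> 'rV[R]_k) : Prop :=
  forall j, L2 Omega (fun x => u x 0 j).

Definition ip Omega (f g : 'rV[R]_n -> R) : R :=
  \int[lebn]_(x in Omega) (f x * g x).

Definition ipv Omega {k : nat} (u v : 'rV[R]_n -> 'rV[R]_k) : R :=
  \int[lebn]_(x in Omega) dot (u x) (v x).

End calculus.

(* Vorticities: scalars for n = 2, vectors for n = 3. *)
Definition vdim (n : nat) : nat := if n == 3%N then 3 else 1.

Definition comp {R : realType} {k : nat} (u : 'rV[R]_k) (j : nat) : R :=
  if insub j is Some i then u 0 i else 0.

Definition cross3 {R : realType} {k l : nat}
    (u : 'rV[R]_k) (v : 'rV[R]_l) : seq R :=
  [:: comp u 1 * comp v 2 - comp u 2 * comp v 1;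
      comp u 2 * comp v 0 - comp u 0 * comp v 2;
      comp u 0 * comp v 1 - comp u 1 * comp v 0].

(* nu x r for a vorticity r; for n = 2 it is [nu_2 r, - nu_1 r]^T. *)
Definition crossr {R : realType} {n : nat}
    (nu : 'rV[R]_n) (r : 'rV[R]_(vdim n)) : 'rV[R]_n :=
  \row_(i < n) (if n == 2%N then [:: comp nu 1 * comp r 0; - (comp nu 0 * comp r 0)]
                else cross3 nu r)`_i.

(* nu x q for a vector q; for n = 2 it is nu_1 q_2 - nu_2 q_1. *)
Definition crossq {R : realType} {n : nat}
    (nu q : 'rV[R]_n) : 'rV[R]_(vdim n) :=
  \row_(i < vdim n) (if n == 2%N then [:: comp nu 0 * comp q 1 - comp nu 1 * comp q 0]
                     else cross3 nu q)`_i.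

(* nabla x q, i.e. crossq with the components of nu replaced by derivatives. *)
Definition curlq {R : realType} {n : nat} (q : 'rV[R]_n -> 'rV[R]_n)
    (x : 'rV[R]_n) : 'rV[R]_(vdim n) :=
  \sum_(i < n) crossq (basis i) (partial i q x).

Section spaces.
Context {R : realType} {n : nat}.
Implicit Types (Omega Gp : set 'rV[R]_n) (r : 'rV[R]_n -> 'rV[R]_(vdim n))
  (q : 'rV[R]_n -> 'rV[R]_n) (p : 'rV[R]_n -> R).

(* c = nabla x r and d = nabla . q in the sense of distributions on Omega. *)
Definition is_wcurl Omega r (c : 'rV[R]_n -> 'rV[R]_n) : Prop :=
  L2v Omega c /\
  forall phi : 'rV[R]_n -> 'rV[R]_n, test_field Omega phi ->
    ipv Omega c phi = ipv Omega r (curlq phi).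

Definition is_wdiv Omega q (d : 'rV[R]_n -> R) : Prop :=
  L2 Omega d /\
  forall phi, test_function Omega phi -> ip Omega d phi = - ipv Omega q (grad phi).

(* A representative of the weak curl (divergence), which is unique up to a
   null set; 0 if there is none. *)
Definition wcurl Omega r : 'rV[R]_n -> 'rV[R]_n :=
  xget (fun=> 0) [set c | is_wcurl Omega r c].

Definition wdiv Omega q : 'rV[R]_n -> R :=
  xget (fun=> 0) [set d | is_wdiv Omega q d].

Definition Hcurl Omega r : Prop := L2v Omega r /\ exists c, is_wcurl Omega r c.

Definition Hdiv Omega q : Prop := L2v Omega q /\ exists d, is_wdiv Omega q d.

(* The weak traces, through Green's formulas
     <nu x r, phi> = <nabla x r, phi> - <r, nabla x phi>  and
     <nu . q, phi> = <nabla . q, phi> + <q, nabla phi>,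
   vanish on Gq when they vanish against every phi that is zero on the
   remaining part of the boundary. *)
Definition tangential_trace0 Omega (Gq : set 'rV[R]_n) r : Prop :=
  forall phi : 'rV[R]_n -> 'rV[R]_n, test_field setT phi ->
    (forall x, (boundary Omega `\` Gq) x -> phi x = 0) ->
    ipv Omega (wcurl Omega r) phi - ipv Omega r (curlq phi) = 0.

Definition normal_trace0 Omega (Gq : set 'rV[R]_n) q : Prop :=
  forall phi : 'rV[R]_n -> R, test_function setT phi ->
    (forall x, (boundary Omega `\` Gq) x -> phi x = 0) ->
    ip Omega (wdiv Omega q) phi + ipv Omega q (grad phi) = 0.

Definition Rspace Omega (Gq : set 'rV[R]_n) r : Prop :=
  Hcurl Omega r /\ tangential_trace0 Omega Gq r.

Definition Qspace Omega (Gq : set 'rV[R]_n) q : Prop :=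
  Hdiv Omega q /\ normal_trace0 Omega Gq q.

Definition Pspace Omega p : Prop := L2 Omega p.

Definition Xnorm Omega r q p : R :=
  Num.sqrt (ipv Omega r r + ipv Omega (wcurl Omega r) (wcurl Omega r) +
            ipv Omega q q + ip Omega (wdiv Omega q) (wdiv Omega q) +
            ip Omega p p).

End spaces.

Section domain.
Context {R : realType} {n : nat}.
Implicit Types (Omega G : set 'rV[R]_n).

(* Near each of its boundary points, Omega is the set of points above the
   graph, in some direction e, of a Lipschitz function on the orthogonal
   complement of e. *)
Definition lipschitz_boundary Omega : Prop :=
  forall x, boundary Omega x ->
  exists (eps L : R) (e : 'rV[R]_n) (gamma : 'rV[R]_n -> R),
    [/\ 0 < eps, enorm e = 1,
        forall y z, `|gamma y - gamma z| <= L * enorm (y - z) &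
        forall y, enorm (y - x) < eps ->
          (Omega y <-> gamma (y - dot y e *: e) < dot y e)].

Definition lipschitz_domain Omega : Prop :=
  [/\ open Omega, connected Omega, Omega !=set0, bounded_set Omega &
      lipschitz_boundary Omega].

Definition simply_connected Omega : Prop :=
  forall c : R -> 'rV[R]_n,
    {within `[0, 1], continuous c} -> c @` `[0, 1] `<=` Omega -> c 0 = c 1 ->
  exists (H : R * R -> 'rV[R]_n) (a : 'rV[R]_n),
    [/\ {within (`[0, 1] `*` `[0, 1]), continuous H},
        H @` (`[0, 1] `*` `[0, 1]) `<=` Omega,
        forall t, 0 <= t <= 1 -> H (0, t) = c t,
        forall t, 0 <= t <= 1 -> H (1, t) = a &
        forall s, 0 <= s <= 1 -> H (s, 0) = H (s, 1)].

Definition is_normal Omega (x nu : 'rV[R]_n) : Prop :=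
  [/\ enorm nu = 1,
      forall e, dot e nu < 0 -> \forall t \near 0^'+, Omega (x + t *: e) &
      forall e, 0 < dot e nu -> \forall t \near 0^'+, ~ Omega (x + t *: e)].

(* The outward unit normal, defined surf-almost everywhere on the boundary of a
   Lipschitz domain. *)
Definition normal Omega (x : 'rV[R]_n) : 'rV[R]_n :=
  xget 0 [set nu | is_normal Omega x nu].

(* The boundary values from within Omega. *)
Definition trace Omega {k : nat} (u : 'rV[R]_n -> 'rV[R]_k) (x : 'rV[R]_n) :
    'rV[R]_k :=
  lim (u y @[y --> within Omega (nbhs x)]).

Definition bnorm G (u : 'rV[R]_n -> R) : \bar R :=
  ((\int[surf]_(x in G) (u x ^+ 2)%:E) `^ 2^-1)%E.

Definition rigid_motion (phi : 'rV[R]_n -> 'rV[R]_n) : Prop :=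
  exists (W : 'M[R]_n) (a : 'rV[R]_n),
    W^T = - W /\ forall x, phi x = x *m W + a.

Definition boundary_decomposition Omega (Gp Gq : set 'rV[R]_n) : Prop :=
  [/\ measurable Gp, measurable Gq, Gp `|` Gq = boundary Omega,
      Gp `&` Gq = set0 & Gp !=set0] /\
  forall phi, rigid_motion phi -> phi <> (fun=> 0) ->
    (0 < bnorm Gq (fun x => dot (normal Omega x) (phi x)) +
         bnorm Gp (fun x => enorm (crossq (normal Omega x) (phi x))))%E.

End domain.

Section forms.
Context {R : realType} {n : nat}.
Implicit Types (Omega Gp : set 'rV[R]_n).
Local Notation vorticity := ('rV[R]_n -> 'rV[R]_(vdim n)).
Local Notation velocity := ('rV[R]_n -> 'rV[R]_n).
Local Notation pressure := ('rV[R]_n -> R).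
Implicit Types (r : vorticity) (q : velocity) (p : pressure).

(* The bilinear form B, in which the first term <mu^-1 r, r'> is a parameter:
   the L2 inner product in B, the quadrature rule in B_h. *)
Definition Bform (mass : vorticity -> vorticity -> R) (mu : R) Omega
    (r : vorticity) (q : velocity) (p : pressure)
    (r' : vorticity) (q' : velocity) (p' : pressure) : R :=
  mass (fun x => mu^-1 *: r x) r' - ipv Omega q (wcurl Omega r')
  + ipv Omega (wcurl Omega r) q' - ip Omega p (wdiv Omega q')
  + ip Omega (wdiv Omega q) p'.

Definition B (mu : R) Omega := Bform (ipv Omega) mu Omega.

Definition load Omega Gp (p0 : 'rV[R]_n -> R) (q0 g : 'rV[R]_n -> 'rV[R]_n)
    r q p : R :=
  \int[surf]_(x in Gp) dot (q0 x) (crossr (normal Omega x) (trace Omega r x))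
  + ipv Omega g q
  - \int[surf]_(x in Gp) (p0 x * dot (normal Omega x) (trace Omega q x)).

(* Fields for which [trace] computes the weak traces. *)
Definition has_trace Omega {k : nat} (u : 'rV[R]_n -> 'rV[R]_k) : Prop :=
  (exists M : R, {ae lebn, forall x, Omega x -> enorm (u x) <= M}) /\
  {ae surf, forall x, boundary Omega x ->
    cvg (u y @[y --> within Omega (nbhs x)])}.

(* The data p0, q0 are integrable functions for which f is bounded on X; as f is
   written with pointwise traces, the bound is for the fields that have them. *)
Definition boundary_data Omega Gp Gq (p0 : 'rV[R]_n -> R)
    (q0 g : 'rV[R]_n -> 'rV[R]_n) : Prop :=
  [/\ surf.-integrable Gp (EFin \o p0),
      forall i, surf.-integrable Gp (fun x => (q0 x 0 i)%:E) &
      exists C : R, forall r q p,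
        Rspace Omega Gq r -> Qspace Omega Gq q -> Pspace Omega p ->
        has_trace Omega r -> has_trace Omega q ->
        `|load Omega Gp p0 q0 g r q p| <= C * Xnorm Omega r q p].

End forms.

Section discretisation.
Context {R : realType} {n : nat}.

(* A simplex is the matrix whose rows are its vertices; a mesh is a list of
   simplices. *)
Local Notation simplex := 'M[R]_(n.+1, n).
Implicit Types (V W : simplex) (Th : seq simplex) (Omega : set 'rV[R]_n).

Definition vertices V : set 'rV[R]_n := [set row i V | i in setT].

Definition barycentric (l : 'rV[R]_n.+1) : Prop :=
  (forall i, 0 <= l 0 i) /\ \sum_i l 0 i = 1.

Definition hull V : set 'rV[R]_n := [set l *m V | l in barycentric].

Definition common_face V W : set 'rV[R]_n :=
  [set l *m V | l in
     [set l | barycentric l /\ forall i, l 0 i != 0 -> vertices W (row i V)]].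

Definition affinely_independent V : Prop :=
  forall l : 'rV[R]_n.+1, \sum_i l 0 i = 0 -> l *m V = 0 -> l = 0.

Definition simplicial_mesh Omega Th : Prop :=
  [/\ uniq Th, forall V, V \in Th -> affinely_independent V,
      closure Omega = \bigcup_(V in [set` Th]) hull V &
      forall V W, V \in Th -> W \in Th -> V != W ->
        vertices V <> vertices W /\ hull V `&` hull W = common_face V W].

Definition diam V : R :=
  \big[Num.max/0]_(i < n.+1) \big[Num.max/0]_(j < n.+1) enorm (row i V - row j V).

Definition mesh_size Th : R := \big[Num.max/0]_(V <- Th) diam V.

(* A family of meshes, indexed by the set H of their mesh sizes. *)
Definition shape_regular_family Omega (H : set R) (mesh : R -> seq simplex) : Prop :=
  (forall h, H h -> simplicial_mesh Omega (mesh h) /\ mesh_size (mesh h) = h) /\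
  exists sigma : R, forall h V, H h -> V \in mesh h ->
    exists (c : 'rV[R]_n) (rho : R),
      [/\ 0 < rho, forall x, enorm (x - c) <= rho -> hull V x &
          diam V <= sigma * rho].

Definition elementwise_linear Th {k : nat} (u : 'rV[R]_n -> 'rV[R]_k) : Prop :=
  forall V, V \in Th -> exists (A : 'M[R]_(n, k)) (b : 'rV[R]_k),
    forall x, (hull V)° x -> u x = x *m A + b.

(* Linear Nedelec elements of the second kind for n = 3, continuous piecewise
   linear Lagrange elements for n = 2. *)
Definition Rh Omega (Gq : set 'rV[R]_n) Th (r : 'rV[R]_n -> 'rV[R]_(vdim n)) : Prop :=
  [/\ Rspace Omega Gq r, elementwise_linear Th r &
      n = 2%N -> {within closure Omega, continuous r}].

Definition Qh Omega (Gq : set 'rV[R]_n) Th (q : 'rV[R]_n -> 'rV[R]_n) : Prop :=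
  Qspace Omega Gq q /\
  forall V, V \in Th -> exists (a : 'rV[R]_n) (b : R),
    forall x, (hull V)° x -> q x = a + b *: x.

Definition Ph Omega Th (p : 'rV[R]_n -> R) : Prop :=
  Pspace Omega p /\
  forall V, V \in Th -> exists c : R, forall x, (hull V)° x -> p x = c.

(* The value at the i-th vertex of V is that of the restriction to V: the
   limit from the interior of V. *)
Definition quad Th {k : nat} (u v : 'rV[R]_n -> 'rV[R]_k) : R :=
  \sum_(V <- Th) fine (lebn (hull V)) / n.+1%:R *
    \sum_(i < n.+1) dot (trace (hull V)° u (row i V)) (trace (hull V)° v (row i V)).

Definition Bh (mu : R) Omega Th := Bform (@quad Th (vdim n)) mu Omega.

End discretisation.

(* Main.v *)
Require Import Defs.
From HB Require Import structures.
From mathcomp Require Import all_boot all_order all_algebra.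
From mathcomp Require Import all_classical all_reals all_analysis.
From mathcomp Require Import measurable_realfun.
From mathcomp Require Import ring lra.

Set Implicit Arguments.
Unset Strict Implicit.
Unset Printing Implicit Defensive.

Import Order.TTheory GRing.Theory Num.Theory.
Import numFieldNormedType.Exports.
Local Open Scope classical_set_scope.
Local Open Scope ring_scope.

(** Why the discrete velocity is solenoidal.

    Subtracting the discrete equation tested with (r_h, q_h, 0) from the one
    tested with (r_h, q_h, p) leaves only the terms in which p occurs.  As the
    load does not see the pressure component, the outcome is
    <div q_h, p> = 0 for every p in P_h.  It remains to put the weak divergence
    d of q_h into P_h, that is, to test with p = d.

    The catch is that d is only a representative, in the sense of
    distributions, of the divergence: that it is almost everywhere equal to a
    constant on each simplex has to be extracted from the weak formulation.  On
    the interior of a simplex, q_h x = a + b x with b a scalar, and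
    [is_wdiv_affine] shows that d = n b almost everywhere there.  Its proof is
    the fundamental lemma of the calculus of variations, organised around boxes
    and functions with separated variables:
    - [cutoff] is a smooth function of one variable, supported in a given
      interval, that increases to the indicator of the open interval; products
      of cutoffs ([box_cutoff]) are test functions that tend to the indicator
      of a box;
    - the integral over R^n of a product of functions of one variable each is
      the product of their integrals ([integral_lebn_prod]), so that the
      integration by parts of an affine field against [box_cutoff] reduces to
      dimension one ([ipv_affine_grad_box_cutoff]);
    - dominated convergence gives that d - n b has integral zero on all small
      boxes ([integral_obox_eq0]); boxes are stable under intersection and
      generate the Borel sets, so d - n b vanishes almost everywhere
      ([ae_eq0_of_boxes]).

    The test pressure p is then n b on the interior of each simplex and d
    itself elsewhere.  Membership in P_h constrains only the values in the
    interiors of the simplices, so p belongs to P_h, and p = d almost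
    everywhere.  Hence the integral of d^2 vanishes and d = 0 almost everywhere.
    Finally, the interior of a
    simplex, when not empty, meets Omega in an open set of positive measure, on
    which d is both 0 and n b; so b = 0, and the classical divergence n b
    vanishes at each interior point. *)

(** * Boxes of R^n and its Borel sets *)
Section boxes.
Context {R : realType} {n : nat}.
Implicit Types (a b x : 'rV[R]_n) (U : set 'rV[R]_n).

Definition obox a b : set 'rV[R]_n :=
  [set x | forall i, a 0 i < x 0 i < b 0 i].

Definition cbox a b : set 'rV[R]_n :=
  [set x | forall i, a 0 i <= x 0 i <= b 0 i].

Definition oboxes : set (set 'rV[R]_n) :=
  [set A | exists a b, A = obox a b].

Lemma obox_cbox a b : obox a b `<=` cbox a b.
Proof. by move=> x xab i; have /andP[/ltW -> /ltW ->] := xab i. Qed.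

Lemma compact_cbox a b : compact (cbox a b).
Proof.
have /rV_compact := fun i : 'I_n => @segment_compact R (a 0 i) (b 0 i).
by congr compact; apply/seteqP; split => x xab i; have := xab i;
  rewrite /= in_itv.
Qed.

(** Rational corners make the boxes inside an open set countably many, which
    reduces statements about open sets, or almost everywhere on them, to boxes.
    The closed box is kept inside [U] because it is to carry the support of a
    test function. *)
Lemma open_rat_box U x : open U -> U x ->
  exists p q : 'rV[rat]_n,
    obox (map_mx ratr p) (map_mx ratr q) x /\
    cbox (map_mx ratr p) (map_mx ratr q) `<=` U.
Proof.
move=> oU Ux; have /nbhs_ballP[e /= e0 eU] := open_nbhs_nbhs (conj oU Ux).
have lo i : exists p : rat, x 0 i - e < ratr p < x 0 i.
  have [p] := @rat_in_itvoo R (x 0 i - e) (x 0 i) ltac:(lra).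
  by rewrite in_itv; exists p.
have hi i : exists p : rat, x 0 i < ratr p < x 0 i + e.
  have [p] := @rat_in_itvoo R (x 0 i) (x 0 i + e) ltac:(lra).
  by rewrite in_itv; exists p.
have [p hp] := choice lo; have [q hq] := choice hi.
exists (\row_i p i), (\row_i q i); split=> [i|y yb].
  by rewrite !mxE; have /andP[_ ->] := hp i; have /andP[-> _] := hq i.
apply: eU; split=> // i j; rewrite (ord1 i).
move: (yb j); rewrite !mxE /ball /= ltr_distl => /andP[? ?].
by have /andP[? ?] := hp j; have /andP[? ?] := hq j; apply/andP; split; lra.
Qed.

Lemma open_sigma_oboxes U : open U -> <<s oboxes >> U.
Proof.
move=> oU.
pose F (pq : 'rV[rat]_n * 'rV[rat]_n) :=
  let A := obox (map_mx ratr pq.1) (map_mx ratr pq.2) in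
  if `[< A `<=` U >] then A else set0.
have -> : U = \bigcup_pq F pq.
  apply/seteqP; split=> [x Ux|x [pq _]]; last first.
    by rewrite /F; case: asboolP => // + ?; exact.
  have [p [q [xpq pqU]]] := open_rat_box oU Ux.
  exists (p, q) => //; rewrite /F; case: asboolP => //= -[].
  by move=> y /obox_cbox; exact: pqU.
apply: (@countable_bigcupT_measurable _ (g_sigma_algebraType oboxes)).
  exact: countableP.
move=> pq; rewrite /F; case: asboolP => // _.
by apply: sub_sigma_algebra; do 2 eexists.
Qed.

(** The class of boxes is stable under intersection, so this generation result
    is what lets two integrals be compared on boxes only. *)
Lemma measurable_oboxes : @measurable _ 'rV[R]_n = <<s oboxes >>.
Proof.
apply/seteqP; split.
  apply: (@sub_g_sigma_preimage R _ (g_sigma_algebraType oboxes) n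
     (fun i v => v 0 i)) => i.
  apply: (measurability _ (RGenOpens.measurableE R)) => _ [_ [x [y ->]] <-].
  rewrite setTI; apply: open_sigma_oboxes.
  apply: (@open_comp 'rV[R]_n R (fun v => v 0 i) `]x, y[); last first.
    exact: interval_open.
  by move=> v _; exact: coord_continuous.
apply: smallest_sub; first exact: sigma_algebra_measurable.
move=> _ [a [b ->]].
have -> : obox a b = \bigcap_i [set x : 'rV[R]_n | x 0 i \in `]a 0 i, b 0 i[].
  apply/seteqP; split=> [x xab i _|x xab i]; have := xab i;
    by rewrite /= in_itv//=; exact.
apply: fin_bigcap_measurable => // i _.
have := @measurable_rV_coord R n i measurableT _ (measurable_itv `]a 0 i, b 0 i[).
by rewrite setTI.
Qed.

Lemma open_measurable_rV U : open U -> measurable U.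
Proof. by rewrite measurable_oboxes; exact: open_sigma_oboxes. Qed.

Lemma open_obox a b : open (obox a b).
Proof.
rewrite openE => x xab; apply: (@filter_forall _ _ _ (nbhs x)) => i.
have : \forall t \near x 0 i, t \in `]a 0 i, b 0 i[.
  by apply: near_in_itvoo; rewrite in_itv /= xab.
move=> /(@coord_continuous R 1 n 0 i x) /=.
by apply: (@filterS _ (nbhs x)) => y; rewrite /= in_itv.
Qed.

End boxes.

(** * Integrals of functions with separated variables *)
Section product_integrals.
Context {R : realType}.

Lemma integral_tensor d1 d2 (T1 : measurableType d1) (T2 : measurableType d2)
    (m1 : {sigma_finite_measure set T1 -> \bar R})
    (m2 : {sigma_finite_measure set T2 -> \bar R}) (g : T1 -> R) (h : T2 -> R) :
  m1.-integrable setT (EFin \o g) -> m2.-integrable setT (EFin \o h) ->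
  (m1 \x m2)%E.-integrable setT (fun z => (g z.1 * h z.2)%:E) /\
  (\int[(m1 \x m2)%E]_z (g z.1 * h z.2) = \int[m1]_x g x * \int[m2]_y h y)%R.
Proof.
move=> ig ih.
have mg : measurable_fun setT g.
  by apply/measurable_EFinP; exact: measurable_int ig.
have mh : measurable_fun setT h.
  by apply/measurable_EFinP; exact: measurable_int ih.
have mgh : measurable_fun setT (fun z : T1 * T2 => (g z.1 * h z.2)%:E).
  apply/measurable_EFinP; apply: measurable_funM.
    exact: (measurableT_comp mg measurable_fst).
  exact: (measurableT_comp mh measurable_snd).
have int2 x : (\int[m2]_y (g x * h y)%:E = (g x)%:E * (\int[m2]_y h y)%:E)%E.
  under eq_integral do rewrite EFinM.
  by rewrite integralZl// /Rintegral fineK//; exact: integrable_fin_num.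
have igh : (m1 \x m2)%E.-integrable setT (fun z => (g z.1 * h z.2)%:E).
  apply/integrable12ltyP => //=.
  have e x : (\int[m2]_y `|(g x * h y)%:E| =
      (`|g x|)%:E * (\int[m2]_y `|h y|)%:E)%E.
    under eq_integral do rewrite /= normrM EFinM.
    rewrite integralZl//; last exact: integrable_norm.
    rewrite /Rintegral fineK//.
    by apply: integrable_fin_num => //; exact: integrable_norm.
  under eq_integral do rewrite e.
  rewrite integralZr//; last exact: integrable_norm.
  rewrite lte_mul_pinfty//.
  - by apply: integral_ge0.
  - by apply: integrable_fin_num => //; exact: integrable_norm.
  - exact: ltry.
split=> //; rewrite /Rintegral -integral12_prod_meas1// /fubini_F /=.
under eq_integral do rewrite int2.
by rewrite integralZr// fineM//; exact: integrable_fin_num.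
Qed.

(* In dimension n + 1, the Lebesgue measure is the image, under the gluing of a
   first coordinate with the remaining ones, of a product measure. *)
Let glue n (x : measurableTypeR R * 'rV[R]_n) : 'rV[R]_n.+1 :=
  row_mx (x.1%:M : 'rV[R]_1) x.2.

Let glue0 n x : @glue n x 0 ord0 = x.1.
Proof.
have -> : (ord0 : 'I_n.+1) = lshift n (0 : 'I_1) by apply/val_inj.
by rewrite /glue (row_mxEl (x.1%:M : 'rV[R]_1) x.2) mxE eqxx mulr1n.
Qed.

Let glueS n x i : @glue n x 0 (lift ord0 i) = x.2 0 i.
Proof.
have -> : lift ord0 i = rshift 1 i by apply/val_inj.
by rewrite /glue (row_mxEr (x.1%:M : 'rV[R]_1) x.2).
Qed.

Let measurable_glue n : measurable_fun setT (@glue n).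
Proof.
apply: measurable_fun_rV => i.
case: (unliftP ord0 i) => [j ->|->].
  under eq_fun do rewrite glueS.
  apply: (measurableT_comp (measurable_rV_coord j) measurable_snd).
under eq_fun do rewrite glue0.
exact: measurable_fst.
Qed.

Let lebnS n : @lebn R n.+1 =
  pushforward (@lebesgue_measure R \x @lebn R n)%E (@glue n).
Proof.
apply/funext => A; rewrite /= /pushforward /product_measure1.
apply: eq_integral => t _ /=; congr (lebn _).
by apply/seteqP; split => v /=; rewrite /xsection /= inE.
Qed.

Let integrable_lebnS n (F : 'rV[R]_n.+1 -> \bar R) :
  measurable_fun setT F ->
  (@lebesgue_measure R \x @lebn R n)%E.-integrable setT (F \o @glue n) ->
  lebn.-integrable setT F.
Proof.
move=> mF iF; rewrite -(preimage_setT (@glue n)) in iF.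
have := integrable_pushforward (measurable_glue (n:=n)) mF iF measurableT.
by congr (integrable _ setT F); rewrite [RHS]lebnS.
Qed.

Let integral_lebnS n (F : 'rV[R]_n.+1 -> \bar R) :
  measurable_fun setT F ->
  (@lebesgue_measure R \x @lebn R n)%E.-integrable setT (F \o @glue n) ->
  (\int[lebn]_(x in setT) F x =
   \int[(@lebesgue_measure R \x @lebn R n)]_z F (glue z))%E.
Proof.
move=> mF iF; have iF' := iF; rewrite -(preimage_setT (@glue n)) in iF'.
have := integral_pushforward (measurable_glue (n:=n)) mF iF' measurableT.
rewrite preimage_setT => <-.
by congr (integral _ setT F); rewrite [LHS]lebnS.
Qed.

(** Fubini, one coordinate at a time.  This is the only form in which integrals
    over R^n get computed, both for volumes and for integration by parts. *)
Lemma integral_lebn_prod n (f : 'I_n -> R -> R) :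
  (forall i, (@lebesgue_measure R).-integrable setT (EFin \o f i)) ->
  lebn.-integrable setT (fun x : 'rV[R]_n => (\prod_i f i (x 0 i))%:E) /\
  \int[lebn]_(x in [set: 'rV[R]_n]) \prod_i f i (x 0 i) =
  \prod_i \int[lebesgue_measure]_t f i t.
Proof.
elim: n f => [|n IHn] f intf.
  under eq_fun do rewrite big_ord0; rewrite big_ord0.
  under eq_Rintegral do rewrite big_ord0.
  have l1 : (@lebn R 0 setT = 1)%E by rewrite /= diracT.
  split.
    apply/integrableP; split; first exact: measurable_cst.
    under eq_integral do rewrite /= normr1.
    by rewrite integral_cst// mul1e [X in (X < _)%E]l1 ltry.
  by rewrite Rintegral_cst// mul1r [X in fine X]l1.
have [ig eg] := IHn (fun i => f (lift ord0 i)) (fun i => intf _).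
have [igh egh] := integral_tensor (intf ord0) ig.
have E x : \prod_i f i (glue x 0 i) =
    f ord0 x.1 * \prod_i f (lift ord0 i) (x.2 0 i) :> R.
  rewrite big_ord_recl glue0; congr (_ * _); apply: eq_bigr => i _.
  by rewrite glueS.
have mf : measurable_fun setT (fun x : 'rV[R]_n.+1 => (\prod_i f i (x 0 i))%:E).
  apply/measurable_EFinP; apply: measurable_prod => i _.
  apply: (measurableT_comp _ (measurable_rV_coord i)).
  by apply/measurable_EFinP; exact: measurable_int (intf i).
have igl : (@lebesgue_measure R \x @lebn R n)%E.-integrable setT
   ((fun x => (\prod_i f i (x 0 i))%:E) \o @glue n).
  by apply: eq_integrable igh => // x _ /=; rewrite E.
split; first exact: integrable_lebnS.
rewrite /Rintegral integral_lebnS// big_ord_recl -eg.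
transitivity (fine (\int[(@lebesgue_measure R \x @lebn R n)%E]_z
    (f ord0 z.1 * \prod_i f (lift ord0 i) (z.2 0 i))%:E)%E); last exact: egh.
by congr fine; apply: eq_integral => z _; rewrite /= E.
Qed.

End product_integrals.

(** * Flat functions of one variable *)
Section flat_functions.
Context {R : realType}.
Implicit Types (p : {poly R}) (t : R).

(** The functions p(1/t) exp(-1/t), extended by 0 to t <= 0: since the
    polynomial [p] is arbitrary, this family is closed under derivation, which
    gives smoothness without computing iterated derivatives. *)
Definition flat p t : R := if 0 < t then p.[t^-1] * expR (- t^-1) else 0.

Lemma flat_le0 p t : t <= 0 -> flat p t = 0.
Proof. by rewrite /flat ltNge => ->. Qed.

(** With s = 1/t, each monomial satisfies s^i exp(-s) <= i!. *)
Lemma flat_bounded p : exists C, forall t, `|flat p t| <= C.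
Proof.
exists (\sum_(i < size p) `|p`_i| * (i`!)%:R) => t; rewrite /flat.
case: ifPn => [t0|_]; last first.
  by rewrite normr0; apply: sumr_ge0 => i _; rewrite mulr_ge0.
rewrite normrM (ger0_norm (expR_ge0 _)) horner_coef.
apply: le_trans (ler_wpM2r (expR_ge0 _) (ler_norm_sum _ _ _)) _.
rewrite mulr_suml; apply: ler_sum => i _.
have s0 : 0 <= t^-1 by rewrite invr_ge0 ltW.
rewrite normrM -mulrA ler_wpM2l// normrX ger0_norm//.
rewrite expRN ler_pdivrMr ?expR_gt0//.
case: (nat_of_ord i) => [|k].
  by rewrite expr0 fact0 mul1r -expR0 ler_expR.
have := expR_ge1Dxn k s0.
rewrite -ler_pdivrMl ?ltr0n ?fact_gt0// mulrC; apply: le_trans.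
by rewrite lerDr.
Qed.

(** The derivative of p(s) exp(-s), s = 1/t, is s^2 (p - p')(s) exp(-s).  At the
    origin, p(s) exp(-s) = t^2 (s^2 p(s)) exp(-s) is O(t^2), because the last
    two factors have a bounded product. *)
Lemma is_derive_flat p t :
  is_derive t 1 (flat p) (flat ('X^2 * (p - p^`())) t).
Proof.
have [t0|t0|->] := ltrgtP t 0.
- rewrite flat_le0 ?ltW//.
  apply: (@near_eq_is_derive _ R R (cst 0)).
  near=> s; rewrite flat_le0//=; apply: ltW; near: s.
  exact: lt_nbhsl.
- apply: (@near_eq_is_derive _ R R (fun s => p.[s^-1] * expR (- s^-1))).
    near=> s; rewrite /flat ifT//; near: s; exact: lt_nbhsr.
  have t0' : t != 0 by rewrite gt_eqF.
  have dV : is_derive t 1 (fun s : R => s^-1) (- t ^- 2).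
    apply: DeriveDef; first exact: derivableV.
    by rewrite deriveV// derive_id scaler1.
  have dp := is_derive1_comp (is_derive_poly p t^-1) dV.
  have de := @is_derive1_comp _ expR (fun s => - s^-1) t _ _
    (is_derive_expR _) (is_deriveN dV).
  apply: is_derive_eq (is_deriveM dp de) _.
  rewrite /flat t0 !hornerE /GRing.scale /= exprVn; field.
  by [].
- rewrite (flat_le0 _ (lexx 0)).
  have [C hC] := flat_bounded ('X^2 * p).
  have C0 : 0 <= C by apply: le_trans (hC 0).
  have bnd h : `|flat p h| <= h ^+ 2 * C.
    have [h0|h0] := leP h 0; first by rewrite flat_le0// normr0 mulr_ge0// sqr_ge0.
    rewrite (_ : flat p h = h ^+ 2 * flat ('X^2 * p) h).
      by rewrite normrM ger0_norm ?sqr_ge0// ler_wpM2l ?sqr_ge0.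
    rewrite /flat h0 hornerM hornerXn exprVn !mulrA divff ?mul1r//.
    by rewrite expf_neq0// gt_eqF.
  have lim0 : h^-1 *: (flat p (h *: (1 : R) + 0) - flat p 0) @[h --> 0^'] --> (0 : R).
    apply/cvgr0Pnorm_le => e e0; near=> h.
    have hn0 : h != 0 by near: h; exact: nbhs_dnbhs_neq.
    rewrite addr0 (flat_le0 _ (lexx 0)) subr0 /GRing.scale /= mulr1 normrM normfV.
    rewrite ler_pdivrMl ?normr_gt0//; apply: le_trans (bnd h) _.
    rewrite -[h ^+ 2]ger0_norm ?sqr_ge0// normrX expr2 -mulrA ler_wpM2l//.
    apply: (@le_trans _ _ (`|h| * (C + 1))); first by rewrite ler_wpM2l// lerDl.
    rewrite -ler_pdivlMr ?ltr_wpDl//.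
    near: h; apply: dnbhs0_le; rewrite divr_gt0// ltr_wpDl//.
  apply: DeriveDef; first by apply/cvg_ex; exists 0.
  exact: cvg_lim lim0.
Unshelve. all: by end_near. Qed.

Lemma is_derive_affine (a b t : R) : is_derive t 1 (fun s => a * s + b) a.
Proof.
have := is_deriveD (is_deriveZ a (is_derive_id t 1)) (is_derive_cst b t 1).
by rewrite addr0 /GRing.scale /= mulr1.
Qed.

Lemma is_derive_flat_affine p (a b t : R) :
  is_derive t 1 (fun s => flat p (a * s + b))
    (a * flat ('X^2 * (p - p^`())) (a * t + b)).
Proof.
rewrite mulrC.
exact: (is_derive1_comp (is_derive_flat p _) (is_derive_affine a b t)).
Qed.

End flat_functions.

(** * Smooth functions of several variables *)
Section smooth_combinations.
Context {R : realType} {n : nat}.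
Implicit Types (f : 'rV[R]_n -> R) (x v : 'rV[R]_n).

(** Reduces directional derivatives to derivatives of functions of one
    variable. *)
Lemma is_derive_line (W : normedModType R) (f : 'rV[R]_n -> W) x v (l : W) :
  is_derive (0 : R) (1 : R) (fun h : R => f (h *: v + x)) l -> is_derive x v f l.
Proof.
move=> [dG <-].
have E : (fun h : R => h^-1 *: (f (h *: v + x) - f x)) =
   (fun h : R => h^-1 *: (f ((h *: (1 : R) + 0) *: v + x) - f (0 *: v + x))).
  by apply/funext => h; rewrite addr0 scale0r add0r /GRing.scale /= mulr1.
by apply: DeriveDef; rewrite /derivable /derive /= E.
Qed.

(** An algebra of functions on which smoothness is proved by induction: all its
    members are differentiable and it is stable under partial derivatives. *)
Inductive flat_combination : ('rV[R]_n -> R) -> Prop :=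
| flat_combination_cst c : flat_combination (fun=> c)
| flat_combination_flat p i c d :
    flat_combination (fun x => flat p (c * x 0 i + d))
| flat_combinationD f g : flat_combination f -> flat_combination g ->
    flat_combination (fun x => f x + g x)
| flat_combinationM f g : flat_combination f -> flat_combination g ->
    flat_combination (fun x => f x * g x).

Lemma flat_combination_differentiable f x :
  flat_combination f -> differentiable f x.
Proof.
move=> F; elim: F x => {f} [c|p i c d|f g _ df _ dg|f g _ df _ dg] x.
- exact: differentiable_cst.
- apply: (@differentiable_comp R 'rV[R]_n R R (fun y => c * y 0 i + d) (flat p)).
    apply: differentiableD; last exact: differentiable_cst.
    apply: differentiableM; first exact: differentiable_cst.
    exact: differentiable_coord.
  by apply/derivable1_diffP; case: (is_derive_flat p (c * x 0 i + d)).
- exact: differentiableD.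
- exact: differentiableM.
Qed.

Lemma flat_combination_partial f j :
  flat_combination f -> flat_combination (partial j f).
Proof.
move=> F; elim: F => {f} [c|p i c d|f g Ff IHf Fg IHg|f g Ff IHf Fg IHg].
- rewrite (_ : partial j _ = fun=> 0); last first.
    by apply/funext => x; rewrite /partial derive_cst.
  exact: flat_combination_cst.
- rewrite (_ : partial j _ = fun x => (c * (i == j)%:R) *
      flat ('X^2 * (p - p^`())) (c * x 0 i + d)); last first.
    apply/funext => x; apply: derive_val; apply: is_derive_line.
    have := is_derive_flat_affine p (c * (i == j)%:R) (c * x 0 i + d) 0.
    rewrite mulr0 add0r; congr is_derive; apply/funext => h.
    by rewrite !mxE eqxx /=; congr flat; ring.
  exact: (flat_combinationM (flat_combination_cst _)
    (flat_combination_flat _ _ _ _)).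
- rewrite (_ : partial j _ = fun x => partial j f x + partial j g x).
    exact: flat_combinationD.
  apply/funext => x; rewrite /partial deriveD//; apply: diff_derivable;
    exact: flat_combination_differentiable.
- rewrite (_ : partial j _ = fun x => f x * partial j g x + g x * partial j f x).
    by apply: flat_combinationD; exact: flat_combinationM.
  apply/funext => x; rewrite /partial deriveM//; apply: diff_derivable;
    exact: flat_combination_differentiable.
Qed.

Lemma flat_combination_prod (I : finType) (F : I -> 'rV[R]_n -> R) :
  (forall i, flat_combination (F i)) ->
  flat_combination (fun x => \prod_i F i x).
Proof.
move=> HF; rewrite unlock; elim: (index_enum I) => [|i s IHs] /=.
  exact: flat_combination_cst.
exact: flat_combinationM.
Qed.

Lemma flat_combination_smooth f : flat_combination f -> smooth f.
Proof.
move=> F s x; apply: flat_combination_differentiable.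
by elim: s => //= j s; exact: flat_combination_partial.
Qed.

End smooth_combinations.

(** * Integration by parts in one variable *)
Section compact_support.
Context {R : realType}.
Implicit Types (f df : R -> R) (a b t : R).
Let lam := @lebesgue_measure R.

Definition supported a b f := forall t, ~~ (a < t < b) -> f t = 0.

Let supportedE a b f : supported a b f -> f = f \_ `[a, b].
Proof.
move=> sf; apply/funext => t; rewrite patchE; case: ifPn => //.
rewrite notin_setE /= in_itv /= => tab; apply: sf.
by apply/negP => /andP[? ?]; apply: tab; rewrite !ltW.
Qed.

Lemma integrable_supported a b f :
  continuous f -> supported a b f -> lam.-integrable setT (EFin \o f).
Proof.
move=> cf /supportedE ->; rewrite -restrict_EFin.
apply: (integrable_mkcond (mu := lam) (EFin \o f) (measurable_itv `[a, b])).1.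
apply: continuous_compact_integrable; first exact: segment_compact.
exact: continuous_subspaceT.
Qed.

Lemma integral_supported_derive a b f df :
  (forall t, is_derive t 1 f (df t)) -> continuous df ->
  supported a b f -> supported a b df -> \int[lam]_t df t = 0.
Proof.
move=> fdf cdf sf sdf.
have [ab|ba] := ltP a b; last first.
  rewrite (_ : df = cst 0) ?Rintegral_cst ?mul0r//.
  apply/funext => t; apply: sdf; apply/negP => /andP[at_ tb].
  by have := lt_trans at_ tb; rewrite ltNge ba.
have cf : continuous f.
  move=> t; apply/differentiable_continuous/derivable1_diffP.
  by case: (fdf t).
rewrite (supportedE sdf) -Rintegral_mkcond /Rintegral.
rewrite (@continuous_FTC2 _ df f)//.
- by rewrite !sf ?ltxx ?andbF// subee.
- exact: continuous_subspaceT.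
- split=> [t _||]; first by case: (fdf t).
  + exact/cvg_at_right_filter/cf.
  + exact/cvg_at_left_filter/cf.
- by move=> t _; rewrite derive1E; apply: derive_val.
Qed.

(** The derivative of (alpha + beta t) f has integral zero, as it has compact
    support. *)
Lemma integral_affine_derive (alpha beta : R) a b f df :
  (forall t, is_derive t 1 f (df t)) -> continuous df ->
  supported a b f -> supported a b df ->
  lam.-integrable setT (EFin \o (fun t => (alpha + beta * t) * df t)) /\
  \int[lam]_t ((alpha + beta * t) * df t) = - (beta * \int[lam]_t f t).
Proof.
move=> fdf cdf sf sdf.
have cf : continuous f.
  move=> t; apply/differentiable_continuous/derivable1_diffP.
  by case: (fdf t).
pose w t := beta * t + alpha.
have cw : continuous w.
  move=> t; apply/differentiable_continuous/derivable1_diffP.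
  by case: (is_derive_affine beta alpha t).
have sw g : supported a b g -> supported a b (fun t => w t * g t).
  by move=> sg t /sg ->; rewrite mulr0.
have iwdf : lam.-integrable setT (EFin \o (fun t => w t * df t)).
  apply: (@integrable_supported a b); last exact: sw.
  by move=> t; apply: continuousM; [exact: cw|exact: cdf].
have iF : lam.-integrable setT (EFin \o f) by exact: integrable_supported sf.
have ibf : lam.-integrable setT (EFin \o (fun t => beta * f t)).
  apply: (@integrable_supported a b); last by move=> t /sf ->; rewrite mulr0.
  by move=> t; apply: continuousM; [exact: cvg_cst|exact: cf].
rewrite (_ : (fun t => _ * df t) = fun t => w t * df t); last first.
  by apply/funext => t; rewrite /w addrC.
split=> //; apply/eqP; rewrite -addr_eq0 -RintegralZl// -RintegralD//; apply/eqP.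
apply: (@integral_supported_derive a b (fun t => w t * f t)).
- move=> t; have := is_deriveM (is_derive_affine beta alpha t) (fdf t).
  by congr is_derive; rewrite /GRing.scale /= mulrC [f t * _]mulrC.
- move=> t; apply: cvgD; last first.
    by apply: continuousM; [exact: cvg_cst|exact: cf].
  by apply: continuousM; [exact: cw|exact: cdf].
- exact: sw.
- by move=> t tab; rewrite sf// sdf// !mulr0 addr0.
Qed.

End compact_support.

(** * Smooth cutoffs of intervals *)
Section cutoff.
Context {R : realType}.
Implicit Types (k : nat) (a b t : R).

(** The product e(K (t - a)) e(K (b - t)) with e = [flat 1] and K = k + 1.  The
    dilation by K makes the sequence tend to the indicator of the open interval,
    since e tends to 1 at infinity.  The arguments are written in the expanded
    form c t + d, the one used in [flat_combination]. *)
Definition cutoff k a b t : R :=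
  flat 1 (k.+1%:R * t - k.+1%:R * a) * flat 1 (- k.+1%:R * t + k.+1%:R * b).

Definition dcutoff k a b t : R :=
  let dflat := flat ('X^2 * (1 - 1^`())) in
  flat 1 (k.+1%:R * t - k.+1%:R * a) *
    (- k.+1%:R * dflat (- k.+1%:R * t + k.+1%:R * b)) +
  flat 1 (- k.+1%:R * t + k.+1%:R * b) *
    (k.+1%:R * dflat (k.+1%:R * t - k.+1%:R * a)).

Lemma is_derive_cutoff k a b t : is_derive t 1 (cutoff k a b) (dcutoff k a b t).
Proof.
exact: (is_deriveM (is_derive_flat_affine _ _ _ _)
                   (is_derive_flat_affine _ _ _ _)).
Qed.

Lemma continuous_cutoff k a b : continuous (cutoff k a b).
Proof.
move=> t; apply/differentiable_continuous/derivable1_diffP.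
by case: (is_derive_cutoff k a b t).
Qed.

Lemma continuous_dcutoff k a b : continuous (dcutoff k a b).
Proof.
have cflat (p : {poly R}) u v : continuous (fun t => flat p (u * t + v)).
  move=> t; apply/differentiable_continuous/derivable1_diffP.
  by case: (is_derive_flat_affine p u v t).
move=> t; apply: cvgD; (apply: cvgM; first exact: cflat);
  by apply: cvgM; [exact: cvg_cst|exact: cflat].
Qed.

Let cutoff_args k a b t : ~~ (a < t < b) ->
  k.+1%:R * t - k.+1%:R * a <= 0 \/ - k.+1%:R * t + k.+1%:R * b <= 0.
Proof.
rewrite negb_and -!leNgt mulNr [- _ + _]addrC !subr_le0 !ler_pM2l ?ltr0n//.
by case/orP; [left|right].
Qed.

Lemma supported_cutoff k a b : supported a b (cutoff k a b).
Proof.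
move=> t /(cutoff_args k)[] h; rewrite /cutoff; first by rewrite flat_le0// mul0r.
by rewrite [X in _ * X]flat_le0// mulr0.
Qed.

Lemma supported_dcutoff k a b : supported a b (dcutoff k a b).
Proof.
move=> t /(cutoff_args k)[] h; rewrite /dcutoff !(flat_le0 _ h);
  by rewrite ?(mul0r, mulr0) addr0.
Qed.

Let flat1_itv t : 0 <= flat 1 t <= 1.
Proof.
rewrite /flat; case: ifPn => [t0|_]; last by rewrite lexx ler01.
by rewrite hornerC mul1r expR_ge0 -expR0 ler_expR oppr_le0 invr_ge0 ltW.
Qed.

Lemma cutoff_ge0 k a b t : 0 <= cutoff k a b t.
Proof.
by rewrite mulr_ge0//; [case/andP: (flat1_itv (k.+1%:R * t - k.+1%:R * a))|
                        case/andP: (flat1_itv (- k.+1%:R * t + k.+1%:R * b))].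
Qed.

Lemma cutoff_le1 k a b t : cutoff k a b t <= 1.
Proof.
have /andP[? ?] := flat1_itv (k.+1%:R * t - k.+1%:R * a).
have /andP[? ?] := flat1_itv (- k.+1%:R * t + k.+1%:R * b).
by rewrite mulr_ile1.
Qed.

Lemma cutoff_cvg a b t : a < t < b -> cutoff k a b t @[k --> \oo] --> (1 : R).
Proof.
have flat1_cvg u : 0 < u -> flat 1 (k.+1%:R * u) @[k --> \oo] --> (1 : R).
  move=> u0; rewrite (_ : (fun k => _) = fun k => expR (- (harmonic k * u^-1))).
    rewrite -[X in _ --> X]expR0 -oppr0 -(mul0r u^-1).
    apply: (continuous_cvg _ (@continuous_expR R _)); apply: cvgN.
    by apply: cvgMl; exact: cvg_harmonic.
  apply/funext => k.
  by rewrite /flat mulr_gt0// hornerC mul1r invfM.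
move=> /andP[at_ tb]; rewrite -[X in _ --> X]mulr1.
rewrite (_ : (fun k => _) =
    fun k => flat 1 (k.+1%:R * (t - a)) * flat 1 (k.+1%:R * (b - t))).
  by apply: cvgM; apply: flat1_cvg; rewrite subr_gt0.
apply/funext => k; rewrite /cutoff; congr (flat _ _ * flat _ _); ring.
Qed.

End cutoff.

(** * Test functions approximating boxes *)
Section box_cutoff.
Context {R : realType} {n : nat}.
Implicit Types (a b x : 'rV[R]_n) (Omega : set 'rV[R]_n).

Definition box_cutoff k a b x : R := \prod_i cutoff k (a 0 i) (b 0 i) (x 0 i).

Lemma box_cutoff_out k a b x : ~ obox a b x -> box_cutoff k a b x = 0.
Proof.
move=> /existsNP[i /negP xi].
by rewrite /box_cutoff (bigD1 i)//= supported_cutoff// mul0r.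
Qed.

Lemma box_cutoff_ge0 k a b x : 0 <= box_cutoff k a b x.
Proof. by apply: prodr_ge0 => i _; exact: cutoff_ge0. Qed.

Lemma box_cutoff_le1 k a b x : box_cutoff k a b x <= 1.
Proof. by apply: prodr_ile1 => i _; rewrite cutoff_ge0 cutoff_le1. Qed.

Lemma box_cutoff_cvg a b x :
  obox a b x -> box_cutoff k a b x @[k --> \oo] --> (1 : R).
Proof.
move=> xab; rewrite /box_cutoff; elim: (index_enum _) => [|i s IHs].
  by under eq_fun do rewrite big_nil; exact: cvg_cst.
under eq_fun do rewrite big_cons.
have := cvgM (cutoff_cvg (xab i)) IHs; rewrite mulr1; exact.
Qed.

Lemma box_cutoff_smooth k a b : smooth (box_cutoff k a b).
Proof.
apply: flat_combination_smooth; apply: flat_combination_prod => i.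
exact: (flat_combinationM (flat_combination_flat _ _ _ _)
  (flat_combination_flat _ _ _ _)).
Qed.

Lemma test_function_box_cutoff Omega k a b :
  cbox a b `<=` Omega -> test_function Omega (box_cutoff k a b).
Proof.
move=> abO; split; first exact: box_cutoff_smooth.
exists (cbox a b); split=> //; first exact: compact_cbox.
by move=> x xab; apply: box_cutoff_out => /obox_cbox.
Qed.

Lemma partial_box_cutoff k a b (i : 'I_n) x :
  partial i (box_cutoff k a b) x =
  dcutoff k (a 0 i) (b 0 i) (x 0 i) *
    \prod_(j | j != i) cutoff k (a 0 j) (b 0 j) (x 0 j).
Proof.
apply: derive_val; apply: is_derive_line.
set C := \prod_(j | _) _.
have E : (fun h : R => box_cutoff k a b (h *: Defs.basis i + x)) =
    (C \*: (cutoff k (a 0 i) (b 0 i) \o (fun h => 1 * h + x 0 i))).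
  apply/funext => h; rewrite /box_cutoff (bigD1 i)//= mulrC; congr (_ * _).
    apply: eq_bigr => j ji; congr cutoff; rewrite !mxE eqxx /= (negbTE ji).
    by rewrite mulr0 add0r.
  by congr cutoff; rewrite !mxE !eqxx mulr1 mul1r.
rewrite E mulrC.
have := is_derive_cutoff k (a 0 i) (b 0 i) (1 * 0 + x 0 i).
move=> /(is_derive1_comp (g := fun h => 1 * h + x 0 i))/(_ (is_derive_affine _ _ _)).
by move/(is_deriveZ C); rewrite mulr1 mulr0 add0r.
Qed.

Lemma integral_box_cutoff k a b :
  lebn.-integrable setT (EFin \o box_cutoff k a b) /\
  \int[lebn]_(x in [set: 'rV[R]_n]) box_cutoff k a b x =
  \prod_i \int[lebesgue_measure]_t cutoff k (a 0 i) (b 0 i) t.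
Proof.
apply: (integral_lebn_prod (f := fun i => cutoff k (a 0 i) (b 0 i))) => i.
apply: (@integrable_supported _ (a 0 i) (b 0 i)).
  exact: continuous_cutoff.
exact: supported_cutoff.
Qed.

(** Integration by parts for the field al + be x, whose divergence is n be.
    Each of the n terms of the scalar product has separated variables, and the
    one-dimensional integration by parts applies to its i-th factor: that term
    contributes - be times the integral of the test function, and al drops
    out. *)
Lemma ipv_affine_grad_box_cutoff k a b (al : 'rV[R]_n) (be : R) :
  ipv setT (fun x => al + be *: x) (grad (box_cutoff k a b)) =
  - (n%:R * be * \int[lebn]_(x in [set: 'rV[R]_n]) box_cutoff k a b x).
Proof.
(* the j-th factor of the i-th term of the scalar product *)
pose F i (j : 'I_n) t := if j == i
  then (al 0 j + be * t) * dcutoff k (a 0 j) (b 0 j) t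
  else cutoff k (a 0 j) (b 0 j) t.
have intF i j : (@lebesgue_measure R).-integrable setT (EFin \o F i j).
  rewrite /F; case: (j == i).
    apply: (integral_affine_derive _ _ (is_derive_cutoff k (a 0 j) (b 0 j)) _ _ _).1.
    - exact: continuous_dcutoff.
    - exact: supported_cutoff.
    - exact: supported_dcutoff.
  apply: (@integrable_supported _ (a 0 j) (b 0 j)); first exact: continuous_cutoff.
  exact: supported_cutoff.
have dotE x : dot (al + be *: x) (grad (box_cutoff k a b) x) =
    \sum_i \prod_j F i j (x 0 j).
  apply: eq_bigr => i _; rewrite !mxE partial_box_cutoff [RHS](bigD1 i)//= /F eqxx mulrA.
  by congr (_ * _); apply: eq_bigr => j /negbTE ->.
have intP i := (integral_lebn_prod (intF i)).1.
have valP i : \int[lebn]_(x in [set: 'rV[R]_n]) \prod_j F i j (x 0 j) =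
   - (be * \int[lebn]_(x in [set: 'rV[R]_n]) box_cutoff k a b x).
  rewrite (integral_lebn_prod (intF i)).2.
  rewrite (integral_box_cutoff k a b).2.
  rewrite (bigD1 i)//= [in RHS](bigD1 i)//= mulrA -mulNr; congr (_ * _); last first.
    by apply: eq_bigr => j /negbTE ji; rewrite /F ji.
  rewrite /F eqxx.
  apply: (integral_affine_derive _ _ (is_derive_cutoff k (a 0 i) (b 0 i)) _ _ _).2.
  - exact: continuous_dcutoff.
  - exact: supported_cutoff.
  - exact: supported_dcutoff.
have -> : ipv setT (fun x => al + be *: x) (grad (box_cutoff k a b)) =
    \sum_i \int[lebn]_(x in [set: 'rV[R]_n]) \prod_j F i j (x 0 j).
  rewrite sum_fine; last by move=> i _; apply: integrable_fin_num.
  rewrite -integral_sum//; congr fine; apply: eq_integral => x _.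
  by rewrite sumEFin dotE.
under eq_bigr do rewrite valP.
by rewrite sumr_const card_ord mulNrn -[in LHS]mulr_natl mulrA.
Qed.

End box_cutoff.

(** * Integrals over boxes determine a function *)
Section localisation.
Context {R : realType} {n : nat}.
Implicit Types (a b x : 'rV[R]_n) (U Omega : set 'rV[R]_n).

Lemma measurable_obox a b : measurable (obox a b).
Proof. by apply: open_measurable_rV; exact: open_obox. Qed.

Lemma lebn_obox a b : (forall i, a 0 i <= b 0 i) ->
  lebn (obox a b) = (\prod_i (b 0 i - a 0 i))%:E.
Proof.
move=> ab.
have lam_itv i : @lebesgue_measure R `]a 0 i, b 0 i[%classic = (b 0 i - a 0 i)%:E.
  rewrite lebesgue_measure_itv /= lte_fin.
  have := ab i; rewrite le_eqVlt => /orP[/eqP ->|->]; last by [].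
  by rewrite ltxx subrr.
have int1 i : (@lebesgue_measure R).-integrable setT
    (EFin \o (\1_`]a 0 i, b 0 i[ : R -> R)).
  apply/integrableP; split; first exact/measurable_EFinP/measurable_indic.
  under eq_integral do rewrite /= ger0_norm//.
  by rewrite integral_indic// setIT [X in (X < _)%E]lam_itv ltry.
have [ip ep] := integral_lebn_prod int1.
have E (x : 'rV[R]_n) :
    \prod_i \1_`]a 0 i, b 0 i[ (x 0 i) = \1_(obox a b) x :> R.
  rewrite indicE; case: (boolP (x \in _)) => [|]; rewrite ?inE ?notin_setE => xab.
    by rewrite big1// => i _; rewrite indicE mem_set//= in_itv /=; exact: xab.
  have /existsNP[i xi] := xab.
  by rewrite (bigD1 i)//= indicE memNset ?mul0r//= in_itv.
have {}ip : lebn.-integrable setT (EFin \o (\1_(obox a b) : 'rV[R]_n -> R)).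
  by apply: eq_integrable ip => // x _ /=; rewrite E.
move: ep; under eq_Rintegral do rewrite E.
rewrite /Rintegral integral_indic ?setIT//; last exact: measurable_obox.
move=> ep; rewrite -[LHS]fineK.
  congr EFin; rewrite ep; apply: eq_bigr => i _.
  by rewrite integral_indic// setIT [X in fine X]lam_itv.
have := integrable_fin_num measurableT ip.
by rewrite integral_indic ?setIT//; exact: measurable_obox.
Qed.

Lemma lebn_open_gt0 U : open U -> U !=set0 -> (0 < lebn U)%E.
Proof.
move=> oU [x Ux]; have [p [q [xpq pqU]]] := open_rat_box oU Ux.
have pq i : ratr (p 0 i) < ratr (q 0 i) :> R.
  by have /andP[] := xpq i; rewrite !mxE; exact: lt_trans.
apply: (@lt_le_trans _ _
  (lebn (obox (map_mx ratr p) (map_mx ratr q) : set 'rV[R]_n))).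
  rewrite lebn_obox; last by move=> i; rewrite !mxE ltW.
  by rewrite lte_fin prodr_gt0// => i _; rewrite !mxE subr_gt0.
apply: le_measure; rewrite ?inE//; [exact: measurable_obox|exact: open_measurable_rV|].
by move=> y /obox_cbox; exact: pqU.
Qed.

Lemma oboxI a b a' b' : obox a b `&` obox a' b' =
  obox (\row_i Num.max (a 0 i) (a' 0 i)) (\row_i Num.min (b 0 i) (b' 0 i)).
Proof.
apply/seteqP; split=> x.
  move=> [xab xab'] i; rewrite !mxE gt_max lt_min.
  have /andP[h1 h2] := xab i; have /andP[h3 h4] := xab' i.
  by rewrite h1 h2 h3 h4.
move=> h; split=> i; have := h i; rewrite !mxE gt_max lt_min;
  by move=> /andP[/andP[h1 h2] /andP[h3 h4]]; rewrite ?h1 ?h2 ?h3 ?h4.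
Qed.

(** The sets A with zero integral over A and the given box form a Dynkin system
    containing the boxes, hence all Borel sets.  The intersection of a box with
    the given one is again a box inside it, so sub-boxes are enough. *)
Lemma ae_eq0_of_boxes a b (h : 'rV[R]_n -> R) :
  lebn.-integrable (obox a b) (EFin \o h) ->
  (forall a' b', cbox a' b' `<=` cbox a b ->
    (\int[lebn]_(x in obox a' b') (h x)%:E = 0)%E) ->
  {ae lebn, forall x, obox a b x -> h x = 0}.
Proof.
move=> ih h0.
have mB := measurable_obox a b.
suff intA A : measurable A -> (\int[lebn]_(x in A `&` obox a b) (h x)%:E = 0)%E.
  have : ae_eq lebn (obox a b) (EFin \o h) (cst 0%E).
    apply: integral_ae_eq => //.
    move=> E EB mE; rewrite integral0 -[in LHS](setIidl EB); exact: intA.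
  by apply: filterS => x h0x /h0x []; exact.
move=> mA; apply: (@dynkin_induction _ _ oboxes
  (fun A => \int[lebn]_(x in A `&` obox a b) (h x)%:E = 0)%E _ _ _ _ _ _ A) => //.
- exact: measurable_oboxes.
- move=> _ _ [a1 [b1 ->]] [a2 [b2 ->]]; rewrite oboxI; do 2 eexists; reflexivity.
- by rewrite setTI; exact: h0.
- move=> _ [a1 [b1 ->]]; rewrite oboxI; apply: h0 => x hx i.
  have := hx i; rewrite !mxE ge_max le_min => /andP[/andP[_ ->] /andP[_ ->]] //.
- move=> S mS S0; have := h0 a b (fun _ => id).
  have SB : (S `&` obox a b) `|` (~` S `&` obox a b) = obox a b.
    by rewrite -setIUl setUv setTI.
  rewrite -[in LHS]SB integral_setU//.
  + by rewrite S0 add0e.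
  + exact: measurableI.
  + by apply: measurableI => //; exact: measurableC.
  + by rewrite SB; case/integrableP: ih.
  + by rewrite disj_set2E; apply/eqP; rewrite setIACA setICr set0I.
- move=> F mF tF F0; rewrite setI_bigcupl integral_bigcup.
  + by apply: eseries0 => i _ _; exact: F0.
  + exact: trivIset_setIr.
  + by move=> k; exact: measurableI.
  + apply: integrableS ih => //; last by move=> x [k _ []].
    by apply: bigcupT_measurable => k; exact: measurableI.
- by rewrite -measurable_oboxes.
Qed.

End localisation.

(** * The weak divergence of an affine field *)
Section affine_divergence.
Context {R : realType} {n : nat}.
Implicit Types (a b x : 'rV[R]_n) (U Omega : set 'rV[R]_n) (d h : 'rV[R]_n -> R).

Lemma lebn_obox_lty a b : (lebn (obox a b) < +oo)%E.
Proof.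
have [ab|nab] := pselect (forall i, a 0 i <= b 0 i); first by rewrite lebn_obox ?ltry.
rewrite (_ : obox a b = set0) ?measure0//; apply/seteqP; split=> // x xab.
by apply: nab => i; have /andP[/ltW h1 /ltW h2] := xab i; exact: le_trans h2.
Qed.

Lemma integrable_cst_obox a b (c : R) :
  lebn.-integrable (obox a b) (cst c%:E).
Proof.
apply/integrableP; split; first exact: measurable_cst.
under eq_integral do rewrite /=.
rewrite integral_cst; last exact: measurable_obox.
by rewrite lte_mul_pinfty//; exact: lebn_obox_lty.
Qed.

Lemma L2_integrable_obox Omega a b d : measurable Omega ->
  obox a b `<=` Omega -> L2 Omega d -> lebn.-integrable (obox a b) (EFin \o d).
Proof.
move=> mO abO [md d2].
have mB := measurable_obox a b.
have mdB : measurable_fun (obox a b) d by exact: measurable_funS md.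
have i1 : lebn.-integrable (obox a b) (cst 1%E).
  exact: integrable_cst_obox.
have i2 : lebn.-integrable (obox a b) (fun x => (d x ^+ 2)%:E).
  apply: (@integrableS _ _ _ _ Omega) => //.
  apply/integrableP; split.
    by apply/measurable_EFinP; exact: measurable_funX.
  by under eq_integral do rewrite gee0_abs ?lee_fin ?sqr_ge0//.
apply: (le_integrable mB _ _ (integrableD mB i1 i2)).
  exact/measurable_EFinP.
move=> x _ /=; rewrite lee_fin [leRHS]ger0_norm ?addr_ge0 ?sqr_ge0//.
have := sqr_ge0 (`|d x| - 1); rewrite -[d x ^+ 2]real_normK ?num_real//.
by nra.
Qed.

Lemma Rintegral_subset (A B : set 'rV[R]_n) (f : 'rV[R]_n -> R) :
  B `<=` A -> (forall x, ~ B x -> f x = 0) ->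
  \int[lebn]_(x in A) f x = \int[lebn]_(x in B) f x.
Proof.
move=> BA f0; rewrite Rintegral_mkcond [RHS]Rintegral_mkcond.
apply: eq_Rintegral => x _; rewrite !patchE.
case: (boolP (x \in B)) => [|]; rewrite ?inE ?notin_setE => Bx.
  by rewrite mem_set//; exact: BA.
by rewrite f0// if_same.
Qed.

Lemma grad_box_cutoff_out k a b x : ~ obox a b x -> grad (box_cutoff k a b) x = 0.
Proof.
move=> /existsNP[j /negP xj]; apply/rowP => i; rewrite !mxE partial_box_cutoff.
have [ij|ij] := eqVneq j i; first by rewrite -ij supported_dcutoff ?mul0r.
by rewrite (bigD1 j)//= supported_cutoff// mul0r mulr0.
Qed.

Let norm_mul_box_cutoff k a b h x :
  (`|(h x * box_cutoff k a b x)%:E| <= (`|h x|)%:E)%E.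
Proof.
rewrite lee_fin normrM [X in _ * X <= _]ger0_norm ?box_cutoff_ge0//.
by rewrite ler_piMr// box_cutoff_le1.
Qed.

Lemma integrable_mul_box_cutoff k a b h :
  lebn.-integrable (obox a b) (EFin \o h) ->
  lebn.-integrable (obox a b) (EFin \o (fun x => h x * box_cutoff k a b x)).
Proof.
move=> ih; have mB := measurable_obox a b.
apply: (le_integrable mB _ _ (integrable_norm ih)).
  apply/measurable_EFinP; apply: measurable_funM.
    by case/integrableP: ih => /measurable_EFinP.
  apply: (@measurable_funS _ _ _ _ setT) => //; apply/measurable_EFinP.
  by case/integrableP: (integral_box_cutoff k a b).1.
move=> x _; apply: (le_trans (norm_mul_box_cutoff k a b h x)).
by rewrite lee_fin /= normr_id.
Qed.

(** Dominated convergence, with [`|h|] as a bound: the cutoffs take values in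
    [0, 1] and tend to 1 on the box. *)
Lemma integral_obox_eq0 a b h : lebn.-integrable (obox a b) (EFin \o h) ->
  (forall k, \int[lebn]_(x in obox a b) (h x * box_cutoff k a b x) = 0) ->
  (\int[lebn]_(x in obox a b) (h x)%:E = 0)%E.
Proof.
move=> ih h0; have mB := measurable_obox a b.
have ihk k := integrable_mul_box_cutoff k ih.
have [||||_ _] := @dominated_convergence _ _ R lebn (obox a b) mB
  (fun k x => (h x * box_cutoff k a b x)%:E) (EFin \o h)
  (EFin \o (Num.norm \o h)) (fun k => measurable_int _ (ihk k)).
- exact: measurable_int ih.
- apply/aeW => x xab; apply: cvg_EFin; first by exact: nearW.
  rewrite /= -[X in _ --> X]mulr1; apply: cvgMr; exact: box_cutoff_cvg.
- exact: integrable_norm.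
- by apply/aeW => x k _; exact: norm_mul_box_cutoff.
move=> /cvg_lim <-//.
have E k : (\int[lebn]_(x in obox a b) (h x * box_cutoff k a b x)%:E = 0)%E.
  rewrite -[LHS]fineK; first by congr EFin; exact: h0.
  exact: integrable_fin_num (ihk k).
by under eq_fun do rewrite E; exact: lim_cst.
Qed.

(** Only the values of [q] on [U] matter because the test functions are
    supported in [U]; the integrals over [Omega], over the box and over the
    whole space then coincide, and [ipv_affine_grad_box_cutoff] applies. *)
Lemma is_wdiv_affine Omega U (q : 'rV[R]_n -> 'rV[R]_n) d (al : 'rV[R]_n)
    (be : R) :
  measurable Omega -> open U -> U `<=` Omega ->
  (forall x, U x -> q x = al + be *: x) -> is_wdiv Omega q d ->
  {ae lebn, forall x, U x -> d x = n%:R * be}.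
Proof.
move=> mO oU UO qU [d2 hd].
have box0 a b : cbox a b `<=` U ->
    (\int[lebn]_(x in obox a b) (d x - n%:R * be)%:E = 0)%E.
  move=> abU.
  have abU' : obox a b `<=` U by move=> x /obox_cbox /abU.
  have abO : obox a b `<=` Omega by exact: subset_trans UO.
  have mB := measurable_obox a b.
  have id := L2_integrable_obox mO abO d2.
  apply: integral_obox_eq0.
    exact: (integrableB mB id (integrable_cst_obox a b (n%:R * be))).
  move=> k.
  have := hd _ (test_function_box_cutoff k (subset_trans abU UO)).
  rewrite /ip (Rintegral_subset abO); last first.
    by move=> x /box_cutoff_out ->; rewrite mulr0.
  have -> : ipv Omega q (grad (box_cutoff k a b)) =
      ipv setT (fun x => al + be *: x) (grad (box_cutoff k a b)).
    have dot0 (v : 'rV[R]_n -> 'rV[R]_n) x : ~ obox a b x ->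
        dot (v x) (grad (box_cutoff k a b) x) = 0.
      move=> /grad_box_cutoff_out ->.
      by rewrite /dot big1// => i _; rewrite mxE mulr0.
    rewrite /ipv (Rintegral_subset abO); last exact: (dot0 q).
    rewrite [RHS](@Rintegral_subset _ (obox a b))//; last first.
      exact: (dot0 (fun x => al + be *: x)).
    by apply: eq_Rintegral => x; rewrite inE => /abU' /qU ->.
  rewrite ipv_affine_grad_box_cutoff opprK.
  rewrite [X in _ * X](@Rintegral_subset _ (obox a b))//; last first.
    by move=> x; exact: box_cutoff_out.
  have iphi : lebn.-integrable (obox a b) (EFin \o box_cutoff k a b).
    exact: (@integrableS _ _ _ _ setT) (integral_box_cutoff k a b).1.
  move=> E.
  under eq_Rintegral do rewrite mulrBl.
  rewrite RintegralB//; first by rewrite E RintegralZl// subrr.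
  - exact: integrable_mul_box_cutoff.
  - by have := integrableZl mB (n%:R * be) iphi.
(* The rational boxes inside U, numbered by their corners. *)
pose B (k : nat) : set 'rV[R]_n := if unpickle k is Some (p, q) then
  if `[< cbox (map_mx ratr p) (map_mx ratr q) `<=` U >]
  then obox (map_mx ratr p) (map_mx ratr (q : 'rV[rat]_n)) else set0 else set0.
have : {ae lebn, forall x k, B k x -> d x = n%:R * be}.
  apply: ae_foralln => k; rewrite /B; case: unpickle => [[p r]|]; last exact/aeW.
  case: asboolP => [prU|_]; last exact/aeW.
  set a := map_mx ratr p in prU *; set b := map_mx ratr r in prU *.
  suff : {ae lebn, forall x, obox a b x -> d x - n%:R * be = 0}.
    by apply: filterS => x h /h /eqP; rewrite subr_eq0 => /eqP.
  apply: ae_eq0_of_boxes.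
    have abO : obox a b `<=` Omega by move=> x /obox_cbox/prU/UO.
    exact: (integrableB (measurable_obox a b) (L2_integrable_obox mO abO d2)
      (integrable_cst_obox a b (n%:R * be))).
  by move=> a' b' ab'; apply: box0; exact: subset_trans prU.
apply: filterS => x hx Ux; have [p [r [xpr prU]]] := open_rat_box oU Ux.
by apply: (hx (pickle (p, r))); rewrite /B pickleK; case: asboolP.
Qed.

End affine_divergence.

(** * The classical divergence of a locally affine field *)
Section local_calculus.
Context {R : realType} {n : nat}.

Lemma near_eq_differentiable (V W : normedModType R) (f g : V -> W) x :
  (\near x, f x = g x) -> differentiable g x -> differentiable f x.
Proof.
move=> fg dg; have fgx : f x = g x by exact: nbhs_singleton fg.
have E : f \o shift x = cst (f x) + 'd g x +o_ 0 id.
  apply/eqaddoP => eps eps0; have := diff_locally dg.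
  move=> /eqaddoP /(_ eps eps0); apply: filter_app.
  have : \forall h \near (0 : V), f (h + x) = g (h + x).
    by move: fg; rewrite (near_shift 0) /= subr0.
  by apply: filterS => h fgh /=; rewrite /= /GRing.add /GRing.opp /= fgh fgx.
have dfg := diff_unique (diff_continuous dg) E.
by apply/diff_locallyP; rewrite dfg; split => //; exact: diff_continuous.
Qed.

Lemma differentiable_div_affine (q : 'rV[R]_n -> 'rV[R]_n) (al : 'rV[R]_n)
    (be : R) x :
  (\near x, q x = al + be *: x) -> differentiable q x /\ div q x = n%:R * be.
Proof.
move=> qE; split.
  apply: near_eq_differentiable qE _.
  apply: differentiableD; first exact: differentiable_cst.
  exact: differentiableZ.
rewrite /div (eq_bigr (fun=> be)) ?sumr_const ?card_ord ?mulr_natl// => i _.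
rewrite /partial (@near_eq_derive R 'rV[R]_n R _ (fun y => al 0 i + be * y 0 i)).
  apply: derive_val; apply: is_derive_line.
  have := is_derive_affine be (be * x 0 i + al 0 i) 0; congr is_derive.
  by apply/funext => h; rewrite !mxE !eqxx /=; ring.
by apply: filterS qE => y ->; rewrite !mxE.
Qed.

End local_calculus.

(** * Testing with the divergence *)
Section discrete_divergence.
Context {R : realType} {n : nat}.
Implicit Types (Omega : set 'rV[R]_n) (d p : 'rV[R]_n -> R).

Lemma wdivP Omega Gq (q : 'rV[R]_n -> 'rV[R]_n) :
  Qspace Omega Gq q -> is_wdiv Omega q (wdiv Omega q).
Proof. by move=> [[_ exd] _]; exact: xgetPex. Qed.

(** Measurability of the test pressure, which is constant on the interiors of
    the simplices and equal to the weak divergence elsewhere. *)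
Lemma measurable_fun_finite_cover Omega d p (I : finType) (F : I -> set 'rV[R]_n) :
  measurable Omega -> (forall i, measurable (F i)) ->
  measurable_fun Omega d ->
  (forall i, exists c, forall x, F i x -> p x = c) ->
  (forall x, ~ (exists i, F i x) -> p x = d x) ->
  measurable_fun Omega p.
Proof.
move=> mO mF md pF pd.
(* E 0 is the part of Omega outside all the F i, E k.+1 the part in the k-th. *)
pose E k := if k is k'.+1 then
  (if insub k' is Some j then Omega `&` F (enum_val (j : 'I_#|I|)) else set0)
  else Omega `\` \bigcup_i F i.
have mE k : measurable (E k).
  case: k => [|k] /=; last by case: insubP => // *; exact: measurableI.
  by apply: measurableD => //; apply: fin_bigcup_measurable => // i _; exact: mF.
have -> : Omega = \bigcup_k E k.
  apply/seteqP; split=> [x Ox|x [[|k] _] /=]; last first.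
  - by case: insubP => //= j _ _ [].
  - by case.
  have [[i Fix]|nF] := pselect (exists i, F i x).
    exists (enum_rank i).+1 => //=; rewrite insubT//= => h.
    by rewrite (_ : Sub _ _ = enum_rank i) ?enum_rankK//; apply/val_inj.
  by exists 0%N => //; split=> // -[i _ Fix]; apply: nF; exists i.
apply/measurable_fun_bigcup => // -[|k] /=.
  apply: (@eq_measurable_fun _ _ _ _ _ d).
    move=> x; rewrite inE => -[Ox nF]; apply/esym/pd => -[i Fix].
    by apply: nF; exists i.
  by apply: measurable_funS md => // x [].
case: insubP => [j _ _|_]; last exact: measurable_fun_set0.
have [c hc] := pF (enum_val j).
apply: (@eq_measurable_fun _ _ _ _ _ (cst c)); last exact: measurable_cst.
by move=> x; rewrite inE => -[_ /hc ->].
Qed.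

End discrete_divergence.

Section orthogonality.
Context {R : realType} {n : nat}.
Implicit Types (Omega : set 'rV[R]_n) (d p : 'rV[R]_n -> R).

Lemma L2_ae_eq Omega d p : measurable Omega -> L2 Omega d ->
  measurable_fun Omega p -> {ae lebn, forall x, Omega x -> p x = d x} ->
  L2 Omega p.
Proof.
move=> mO [md d2] mp pd; split => //; move: d2; congr (_ < _)%E.
apply: ae_eq_integral => //.
- by apply/measurable_EFinP; exact: measurable_funX.
- by apply/measurable_EFinP; exact: measurable_funX.
- by apply: filterS pd => x h Ox; rewrite /= h.
Qed.

Lemma ip_ae_eq0 Omega d p : measurable Omega -> L2 Omega d ->
  measurable_fun Omega p -> {ae lebn, forall x, Omega x -> p x = d x} ->
  ip Omega d p = 0 -> {ae lebn, forall x, Omega x -> d x = 0}.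
Proof.
move=> mO [md d2] mp pd ip0.
have mdd : measurable_fun Omega (fun x => (d x ^+ 2)%:E).
  by apply/measurable_EFinP; exact: measurable_funX.
have int_dd : (\int[lebn]_(x in Omega) (d x ^+ 2)%:E = 0)%E.
  rewrite -[LHS]fineK.
    congr EFin; rewrite -ip0; congr fine; apply: ae_eq_integral => //.
      by apply/measurable_EFinP; exact: measurable_funM.
    by apply: filterS pd => x h Ox; rewrite /= h// expr2.
  rewrite ge0_fin_numE//; apply: integral_ge0 => x _.
  by rewrite lee_fin sqr_ge0.
have /(ae_eq_integral_abs _ mO mdd) :
    (\int[lebn]_(x in Omega) `|(d x ^+ 2)%:E| = 0)%E.
  by under eq_integral do rewrite gee0_abs ?lee_fin ?sqr_ge0//.
by apply: filterS => x h /h /= [] /eqP; rewrite sqrf_eq0 => /eqP.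
Qed.

End orthogonality.

(** The test pressure is given by one formula on the union of the interiors of
    the simplices, the classical divergence of [qh]; this makes it single-valued
    and, on each of them, constant. *)
Theorem lemma4p2 (R : realType) (n : nat) (hn : n = 2%N \/ n = 3%N)
    (Omega : set 'rV[R]_n) (hOmega : lipschitz_domain Omega)
    (hsc : simply_connected Omega)
    (mu : R) (hmu : 0 < mu)
    (g : 'rV[R]_n -> 'rV[R]_n) (hg : L2v Omega g)
    (Gp Gq : set 'rV[R]_n) (hG : boundary_decomposition Omega Gp Gq)
    (p0 : 'rV[R]_n -> R) (q0 : 'rV[R]_n -> 'rV[R]_n)
    (hdata : boundary_data Omega Gp Gq p0 q0 g)
    (H : set R) (mesh : R -> seq 'M[R]_(n.+1, n))
    (hmesh : shape_regular_family Omega H mesh) (h : R) (hh : H h)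
    (rh : 'rV[R]_n -> 'rV[R]_(vdim n)) (qh : 'rV[R]_n -> 'rV[R]_n)
    (ph : 'rV[R]_n -> R)
    (hrh : Rh Omega Gq (mesh h) rh) (hqh : Qh Omega Gq (mesh h) qh)
    (hph : Ph Omega (mesh h) ph)
    (hsol : forall r q p, Rh Omega Gq (mesh h) r -> Qh Omega Gq (mesh h) q ->
      Ph Omega (mesh h) p ->
      Bh mu Omega (mesh h) rh qh ph r q p = load Omega Gp p0 q0 g r q p) :
  {ae lebn, forall x, Omega x -> wdiv Omega qh x = 0} /\
  (forall V x, V \in mesh h -> (hull V)° x ->
     differentiable qh x /\ div qh x = 0).
Proof.
have oO : open Omega by case: hOmega.
have mO := open_measurable_rV oO.
have [Qqh RT] := hqh.
have wd := wdivP Qqh.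
set d := wdiv Omega qh in wd *.
have dL2 : L2 Omega d by case: wd.
pose F (i : seq_sub (mesh h)) := (hull (val i))°.
have oF i : open (F i) by exact: open_interior.
have [ab qF] : {ab : seq_sub (mesh h) -> 'rV[R]_n * R |
    forall i x, F i x -> qh x = (ab i).1 + (ab i).2 *: x}.
  suff /choice[ab] : forall i, exists ab : 'rV[R]_n * R, forall x, F i x ->
      qh x = ab.1 + ab.2 *: x by exists ab.
  by move=> i; have [a [b qab]] := RT _ (valP i); exists (a, b).
have divF i x : F i x -> differentiable qh x /\ div qh x = n%:R * (ab i).2.
  move=> Fx; apply: (@differentiable_div_affine _ _ _ (ab i).1).
  have := open_nbhs_nbhs (conj (oF i) Fx); apply: filterS; exact: qF.
have dF i : {ae lebn, forall x, (Omega `&` F i) x -> d x = n%:R * (ab i).2}.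
  apply: (is_wdiv_affine mO _ _ _ wd); [exact: openI|by move=> ? []|].
  by move=> x [_]; exact: qF.
pose p x := if `[< exists i, F i x >] then div qh x else d x.
have pF i x : F i x -> p x = n%:R * (ab i).2.
  move=> Fx; rewrite /p asboolT; last by exists i.
  by have [] := divF i x Fx.
have mp : measurable_fun Omega p.
  apply: (@measurable_fun_finite_cover _ _ _ d _ _ F) => //.
  - by move=> i; exact: open_measurable_rV.
  - by case: dL2.
  - by move=> i; exists (n%:R * (ab i).2) => x; exact: pF.
  - by move=> x nF; rewrite /p asboolF.
have pd : {ae lebn, forall x, Omega x -> p x = d x}.
  have : {ae lebn, forall x i, (Omega `&` F i) x -> d x = n%:R * (ab i).2}.
    exact: filter_forall.
  apply: filterS => x hx Ox; rewrite /p; case: asboolP => // -[i Fx].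
  by rewrite (hx i)//; have [] := divF i x Fx.
have pPh : Ph Omega (mesh h) p.
  split; first exact: (L2_ae_eq mO dL2 mp pd).
  by move=> V Vm; exists (n%:R * (ab (SeqSub Vm)).2) => x; exact: (pF (SeqSub Vm)).
have Ph0 : Ph Omega (mesh h) (fun=> 0).
  split; last by move=> V _; exists 0.
  split; first exact: measurable_cst.
  by under eq_integral do rewrite expr0n; rewrite integral0.
(* Both tests have the same load and the same terms in r and q. *)
have ip0 : ip Omega d p = 0.
  have /addrI -> := etrans (hsol _ _ _ hrh hqh pPh)
                           (esym (hsol _ _ _ hrh hqh Ph0)).
  rewrite /ip.
  by under eq_Rintegral do rewrite mulr0; rewrite Rintegral_cst// mul0r.
have d0 := ip_ae_eq0 mO dL2 mp pd ip0.
split=> // V x Vm Vx; have [dq ->] := divF (SeqSub Vm) x Vx; split=> //.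
(* Otherwise d = 0 and d = n b <> 0 almost everywhere on a nonempty open set. *)
apply: contrapT => b0.
have : (0 < lebn (Omega `&` (hull V)°))%E.
  apply: lebn_open_gt0; first by apply: openI => //; exact: open_interior.
  have [[_ _ clO _] _] := hmesh.1 h hh.
  have : closure Omega x by rewrite clO; exists V => //; exact: interior_subset.
  by move=> /(_ _ (open_nbhs_nbhs (conj (@open_interior _ (hull V)) Vx))).
suff -> : lebn (Omega `&` (hull V)°) = 0%E by rewrite ltxx.
apply/negligibleP.
  by apply: open_measurable_rV; apply: openI => //; exact: open_interior.
have : {ae lebn, forall x, ~ (Omega `&` (hull V)°) x}.
  have := dF (SeqSub Vm); apply: filterS2 d0 => y dy0 dyV OVy.
  by apply: b0; rewrite -dyV// dy0//; case: OVy.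
by apply: negligibleS => y OVy nOVy; exact: nOVy.
Qed.
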